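(* Let $G$ be a connected Lie group with Lie algebra $\mathfrak{g}$, let $\langle\cdot,\cdot\rangle$ be a nondegenerate symmetric bilinear form on $\mathfrak{g}$ such that the pseudo-Riemannian Lie algebra $(\mathfrak{g},\langle\cdot,\cdot\rangle)$ belongs to the class $\mathcal{W}_0$, and suppose that its $U$-tensor is associative, i.e. $U(U(X,Y),Z)=U(X,U(Y,Z))$ for all $X,Y,Z\in\mathfrak{g}$. Then the left-invariant pseudo-Riemannian metric on $G$ determined by $\langle\cdot,\cdot\rangle$ is geodesically complete.
   Context: A pseudo-Riemannian Lie algebra $(\mathfrak{g},\langle\cdot,\cdot\rangle)$ is a finite-dimensional real Lie algebra $\mathfrak{g}$ with a nondegenerate symmetric bilinear form $\langle\cdot,\cdot\rangle$ (of arbitrary signature). If $\mathfrak{g}$ is the Lie algebra of left-invariant vector fields on $G$, then $\langle\cdot,\cdot\rangle$ determines a unique left-invariant pseudo-Riemannian metric $g$ on $G$ with $g(X,Y)=\langle X,Y\rangle$ for $X,Y\in\mathfrak{g}$. The $U$-tensor is the symmetric bilinear map $U:\mathfrak{g}\times\mathfrak{g}\to\mathfrak{g}$ determined by $$2\langle U(X,Y),Z\rangle=\langle[Z,X],Y\rangle+\langle[Z,Y],X\rangle\qquad\text{for all }X,Y,Z\in\mathfrak{g};$$ it is the symmetric part of the Levi-Civita connection $\nabla_XY=\frac12[X,Y]+U(X,Y)$. Put $\theta(X,Y,Z)=\langle U(X,Y),Z\rangle$. The pair $(\mathfrak{g},\langle\cdot,\cdot\rangle)$ belongs to the class $\mathcal{W}_0$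 if $\sum_{i,j}g^{ij}\theta(e_i,e_j,Z)=0$ for all $Z\in\mathfrak{g}$, where $\{e_i\}$ is any basis of $\mathfrak{g}$ and $(g^{ij})$ is the inverse of the matrix $(\langle e_i,e_j\rangle)$. Geodesically complete means that every maximal geodesic of the Levi-Civita connection is defined on all of $\mathbb{R}$. *)

(* Defs.v *)
From HB Require Import structures.
From mathcomp Require Import all_boot all_order all_algebra.
From mathcomp Require Import all_classical all_reals all_analysis.

Set Implicit Arguments.
Unset Strict Implicit.
Unset Printing Implicit Defensive.

Import Order.TTheory GRing.Theory Num.Theory.
Import numFieldNormedType.Exports.

Local Open Scope ring_scope.
Local Open Scope classical_set_scope.

(* Types carrying both a topology and a group law; the compatibility of the two
   is part of the record lieGroup below. *)
#[short(type="topologicalAndGroupType")]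
HB.structure Definition TopologicalAndGroup :=
  {G of Topological G & monoid.Group G}.

Section Smooth.
Variables (R : realType) (V W : normedModType R).

(* f is of class C^k on A; only meant for A open, where differentiability at a
   point of A depends only on the values of f on A. *)
Fixpoint Ck (k : nat) (A : set V) (f : V -> W) : Prop :=
  if k is k'.+1 then
    (forall x, A x -> differentiable f x) /\ (forall v, Ck k' A ('D_v f))
  else {within A, continuous f}.

Definition smooth_on (A : set V) (f : V -> W) := forall k, Ck k A f.

End Smooth.

Record chart (R : realType) (n : nat) (M : topologicalType) := Chart {
  chart_dom : set M ;
  chart_fun :> M -> 'rV[R]_n ;
  chart_inv : 'rV[R]_n -> M ;
  chart_dom_open : open chart_dom ;
  chart_img_open : open (chart_fun @` chart_dom) ;
  chart_funK : {in chart_dom, cancel chart_fun chart_inv} ;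
  chart_fun_cont : {within chart_dom, continuous chart_fun} ;
  chart_inv_cont : {within chart_fun @` chart_dom, continuous chart_inv}
}.

Definition chart_img (R : realType) (n : nat) (M : topologicalType)
  (a : chart R n M) : set 'rV[R]_n := a @` chart_dom a.

(* A real n-dimensional Lie group. The field chart_at singles out one chart of
   the atlas around each point p; the coordinates in chart_at p identify the
   tangent space at p with R^n. *)
Record lieGroup (R : realType) (n : nat) := LieGroup {
  lie_carrier :> topologicalAndGroupType ;
  lie_hausdorff : hausdorff_space lie_carrier ;
  lie_second_countable : @second_countable lie_carrier ;
  atlas : set (chart R n lie_carrier) ;
  chart_at : lie_carrier -> chart R n lie_carrier ;
  chart_at_atlas : forall p, atlas (chart_at p) ;
  chart_at_dom : forall p, chart_dom (chart_at p) p ;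
  atlas_compat : forall a b, atlas a -> atlas b ->
    smooth_on (a @` (chart_dom a `&` chart_dom b)) (b \o chart_inv a) ;
  lie_mul_cont : continuous (fun p : lie_carrier * lie_carrier => (p.1 * p.2)%g) ;
  lie_inv_cont : continuous (fun p : lie_carrier => (p^-1)%g) ;
  lie_mul_smooth : forall a b c, atlas a -> atlas b -> atlas c ->
    smooth_on
      [set z : 'rV[R]_n * 'rV[R]_n | [/\ chart_img a z.1, chart_img b z.2 &
         chart_dom c (chart_inv a z.1 * chart_inv b z.2)%g]]
      (fun z => c (chart_inv a z.1 * chart_inv b z.2)%g) ;
  lie_inv_smooth : forall a b, atlas a -> atlas b ->
    smooth_on [set x | chart_img a x /\ chart_dom b (chart_inv a x)^-1%g]
      (fun x => b (chart_inv a x)^-1%g)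
}.

Section LieAlgebra.
Variables (R : realType) (n : nat) (G : lieGroup R n).
Notation V := 'rV[R]_n.

(* The tangent map of F at p, from a-coordinates to b-coordinates. *)
Definition tangent_map (a b : chart R n G) (F : G -> G) (p : G) : V -> V :=
  'd (b \o F \o chart_inv a) (a p).

Definition left_translation (g : G) : G -> G := fun h => (g * h)%g.

Definition chart1 : chart R n G := chart_at (1%g : G).

(* The left-invariant vector field with value X at 1, in a-coordinates: its
   value at q is the image of X under the differential at 1 of the left
   translation by q. *)
Definition left_invariant_field (a : chart R n G) (X : V) : V -> V :=
  fun x => tangent_map chart1 a (left_translation (chart_inv a x)) 1%g X.

(* Coordinate expression of the commutator of vector fields:
   [X, Y]^i = sum_j (X^j d_j Y^i - Y^j d_j X^i). *)
Definition field_bracket (X Y : V -> V) : V -> V :=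
  fun x => 'D_(X x) Y x - 'D_(Y x) X x.

(* The Lie algebra of G is T_1 G = R^n, read in chart1, with the bracket
   of the corresponding left-invariant vector fields. *)
Definition lie_bracket (X Y : V) : V :=
  field_bracket (left_invariant_field chart1 X) (left_invariant_field chart1 Y)
    (chart1 1%g).

End LieAlgebra.

Arguments lie_bracket {R n} G X Y.

Section PseudoRiemannianLieAlgebra.
Variables (R : realType) (n : nat).
Notation V := 'rV[R]_n.
Variables (br : V -> V -> V) (form : V -> V -> R) (U : V -> V -> V).

Definition form_symmetric := forall X Y, form X Y = form Y X.

Definition form_nondegenerate := forall X, (forall Y, form X Y = 0) -> X = 0.

Definition is_Utensor := forall X Y Z,
  2 * form (U X Y) Z = form (br Z X) Y + form (br Z Y) X.

Definition theta (X Y Z : V) : R := form (U X Y) Z.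

(* The rows of E are the vectors of the basis. *)
Definition gram (E : 'M[R]_n) : 'M[R]_n :=
  \matrix_(i, j) form (row i E) (row j E).

Definition class_W0 := forall E : 'M[R]_n, E \in unitmx -> forall Z : V,
  \sum_i \sum_j invmx (gram E) i j * theta (row i E) (row j E) Z = 0.

Definition associative_U := forall X Y Z, U (U X Y) Z = U X (U Y Z).

End PseudoRiemannianLieAlgebra.

Section Geodesics.
Variables (R : realType) (n : nat) (G : lieGroup R n).
Notation V := 'rV[R]_n.
Variable form : V -> V -> R.

(* The left-invariant metric g with g_1 = form, in a-coordinates:
   g_p(u, v) = <d(L_{p^-1})_p u, d(L_{p^-1})_p v>. *)
Definition left_metric (a : chart R n G) (x u v : V) : R :=
  let p := chart_inv a x in
  let dL := tangent_map a (chart1 G) (left_translation p^-1%g) p in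
  form (dL u) (dL v).

Definition coord_vec (i : 'I_n) : V := delta_mx 0 i.

Definition metric_mx (a : chart R n G) (x : V) : 'M[R]_n :=
  \matrix_(i, j) left_metric a x (coord_vec i) (coord_vec j).

Definition dmetric (a : chart R n G) (x : V) (l i j : 'I_n) : R :=
  'D_(coord_vec l) (fun y => metric_mx a y i j) x.

(* christoffel a x k i j is Gamma^k_ij, for the Levi-Civita connection. *)
Definition christoffel (a : chart R n G) (x : V) (k i j : 'I_n) : R :=
  2^-1 * \sum_l invmx (metric_mx a x) k l *
    (dmetric a x i j l + dmetric a x j i l - dmetric a x l i j).

(* c is the coordinate expression of the curve gamma. *)
Definition geodesic_equation_at (a : chart R n G) (gamma : R -> G) (t : R) :=
  let c : R -> V := a \o gamma in
  let dc : R -> V := derive1 c in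
  let ddc : R -> V := derive1 dc in
  [/\ derivable c t 1, derivable dc t 1 &
      forall k, ddc t 0 k +
        \sum_i \sum_j christoffel a (c t) k i j * dc t 0 i * dc t 0 j = 0].

(* Only the values of gamma on I matter, as I is open. *)
Definition geodesic_on (I : set R) (gamma : R -> G) :=
  [/\ open I, is_interval I, I !=set0, {within I, continuous gamma} &
      forall t, I t -> forall a, atlas a -> chart_dom a (gamma t) ->
        geodesic_equation_at a gamma t].

Definition maximal_geodesic_on (I : set R) (gamma : R -> G) :=
  geodesic_on I gamma /\
  forall J delta, geodesic_on J delta -> I `<=` J ->
    {in I, delta =1 gamma} -> J = I.

Definition geodesically_complete :=
  forall I gamma, maximal_geodesic_on I gamma -> I = setT.

End Geodesics.

(* Main.v *)
(** Left-translating the velocity of a geodesic to the identity gives a curve x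
    in the Lie algebra, and the geodesic equation becomes x' = - U(x, x). Since
    U is symmetric and associative, it makes the Lie algebra a commutative
    associative algebra. Class W_0 says that the traces of all ad Z vanish, and
    the trace of the multiplication operator L_X = U(X, .) is - tr(ad X) / 2;
    so every L_X is traceless. As the L_X form an algebra, an L_X that was not
    nilpotent would produce an idempotent L_Y <> 0, whose trace is its rank.
    Hence all L_X are nilpotent and x is the polynomial x_0 (1 + t x_0)^-1,
    which is defined for all times. The curves with left velocity x
    exist locally around every time and are unique up to a left translation, so
    a geodesic extends past every end point of its interval. *)
From HB Require Import structures.
Require Import Defs.
From mathcomp Require Import all_boot all_order all_algebra.
From mathcomp Require Import all_classical all_reals all_analysis.
From mathcomp Require Import ring lra.

Set Implicit Arguments.
Unset Strict Implicit.
Unset Printing Implicit Defensive.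

Import Order.TTheory GRing.Theory Num.Theory.
Import numFieldNormedType.Exports.

Local Open Scope ring_scope.
Local Open Scope classical_set_scope.

(** * Calculus on row vectors *)

(** The geodesic equation splits in two: one equation for x in the Lie algebra, solved for all
    times, and one for the curve in the group, whose right-hand side is linear in the now known x.
    Only the second calls for an existence theorem, and left translation frees the initial point, so
    it is solved near the identity, in one chart. The algebra has no unit. Hence X (1 + t X)^-1 is
    handled as the solution Y of Y + t U(X, Y) = X, which is unique because L_X is nilpotent.
    Uniqueness of x comes from a first integral, and that of the group curve from the vanishing
    derivative of gamma sigma^-1. The form x' = - U(x, x) comes from the Maurer-Cartan equation,
    which in turn rests on the symmetry of the second derivatives of the group multiplication. *)

Section Calculus.
Variables (R : realType).
Implicit Types (V W : normedModType R).

Lemma smooth_on_differentiable V W (A : set V) (f : V -> W) x :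
  smooth_on A f -> A x -> differentiable f x.
Proof. by move=> /(_ 1%N)[+ _] => /[apply]. Qed.

Lemma smooth_on_derive V W (A : set V) (f : V -> W) v :
  smooth_on A f -> smooth_on A ('D_v f).
Proof. by move=> sf k; have [_] := sf k.+1; exact. Qed.

Lemma is_derive_comp V W (f : V -> W) (c : R -> V) (t : R) v :
  is_derive t 1 c v -> differentiable f (c t) ->
  is_derive t 1 (f \o c) ('D_v f (c t)).
Proof.
move=> [/derivable1_diffP Dc cE] Df.
have dfc : differentiable (f \o c) t by exact: differentiable_comp.
apply: DeriveDef; first exact/derivable1_diffP.
by rewrite deriveE// diff_comp//= -(deriveE _ Dc) cE -deriveE.
Qed.

Lemma derive_comp (U : normedModType R) V W (f : V -> W) (g : U -> V) x v :
  differentiable g x -> differentiable f (g x) ->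
  'D_v (f \o g) x = 'D_('D_v g x) f (g x).
Proof.
move=> dg df; rewrite !deriveE//; last exact: differentiable_comp.
by rewrite diff_comp.
Qed.

Lemma is_derive_pair V W (f : R -> V) (g : R -> W) (t : R) v w :
  is_derive t 1 f v -> is_derive t 1 g w ->
  is_derive t 1 (fun s => (f s, g s)) (v, w).
Proof.
move=> [/derivable1_diffP df fE] [/derivable1_diffP dg gE].
have dp := differentiable_pair df dg.
apply: DeriveDef; first exact/derivable1_diffP.
by rewrite deriveE// diff_pair//= -(deriveE _ df) -(deriveE _ dg) fE gE.
Qed.

Lemma is_derive_line V (x v : V) (t : R) :
  is_derive t 1 (fun s : R => x + s *: v) v.
Proof.
have dv : is_diff t ( *:%R^~ v) ( *:%R^~ v) by exact: is_diff_scalel.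
have [dsv dsvE] := dv.
have dv1 : is_derive t 1 ( *:%R^~ v : R -> V) v.
  apply: DeriveDef; first exact/derivable1_diffP.
  by rewrite deriveE// dsvE scale1r.
by have := is_deriveD (is_derive_cst x t (1 : R)) dv1; rewrite add0r.
Qed.

Lemma is_derive_unique V W (f : V -> W) x v d d' :
  is_derive x v f d -> is_derive x v f d' -> d = d'.
Proof. by move=> [_ <-] [_ <-]. Qed.

Lemma is_derive_mxP V m n (M : V -> 'M[R]_(m, n)) t v dM :
  is_derive t v M dM <-> forall i j, is_derive t v (fun s => M s i j) (dM i j).
Proof.
split=> [[dM_ME <-] i j|dME].
  have dMij := (derivable_mxP M t v).1 dM_ME i j.
  by rewrite derive_mx// mxE; exact: derivableP.
have dM_M : derivable M t v.
  by apply/derivable_mxP => i j; have [] := dME i j.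
apply: DeriveDef => //; rewrite derive_mx//; apply/matrixP => i j.
by rewrite mxE; have [] := dME i j.
Qed.

Lemma is_derive_bigsum V W n (h : 'I_n -> V -> W) x v (dh : 'I_n -> W) :
  (forall i, is_derive x v (h i) (dh i)) ->
  is_derive x v (fun s => \sum_i h i s) (\sum_i dh i).
Proof.
move=> dhE; have -> : (fun s => \sum_i h i s) = \sum_i h i.
  by apply/funext => s; rewrite fct_sumE.
exact: is_derive_sum.
Qed.

Lemma is_derive_mul V (f g : V -> R) x v df dg :
  is_derive x v f df -> is_derive x v g dg ->
  is_derive x v (fun s => f s * g s) (df * g x + f x * dg).
Proof.
move=> dfE dgE; apply: (@is_derive_eq _ _ _ (f * g)); rewrite addrC mulrC.
by congr (_ + _); rewrite mulrC.
Qed.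

Lemma row_linear_sum n W (A : {linear 'rV[R]_n -> W}) y :
  A y = \sum_j y 0 j *: A (delta_mx 0 j).
Proof.
rewrite [in LHS](row_sum_delta y) linear_sum; apply: eq_bigr => j _.
by rewrite linearZ.
Qed.

(** Product rule for a varying linear map at a varying vector. Expansion in the standard basis
    reduces it to real products, so differentiability of [A] is asked only on each fixed vector;
    linearity of [A'] then follows from uniqueness of derivatives. *)
Lemma is_derive_apply_linear V m n (A : V -> {linear 'rV[R]_n -> 'rV[R]_m})
    (A' : 'rV[R]_n -> 'rV[R]_m) (y : V -> 'rV[R]_n) y' t v :
  (forall w, is_derive t v (fun s => A s w) (A' w)) ->
  is_derive t v y y' ->
  is_derive t v (fun s => A s (y s)) (A' (y t) + A t y').
Proof.
move=> dA dy.
have A'E w : A' w = \sum_j w 0 j *: A' (delta_mx 0 j).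
  apply: (is_derive_unique (dA w)).
  have -> : (fun s => A s w) = (fun s => \sum_j w 0 j *: A s (delta_mx 0 j)).
    by apply/funext => s; exact: row_linear_sum.
  by apply: is_derive_bigsum => j; exact: is_deriveZ.
rewrite A'E (row_linear_sum (A t)) -big_split/=.
have -> : (fun s => A s (y s)) =
    (fun s => \sum_j y s 0 j *: A s (delta_mx 0 j)).
  by apply/funext => s; exact: row_linear_sum.
apply: is_derive_bigsum => j; apply/is_derive_mxP => i k.
have -> : (fun s => (y s 0 j *: A s (delta_mx 0 j)) i k) =
    (fun s => y s 0 j * A s (delta_mx 0 j) i k).
  by apply/funext => s; rewrite mxE.
rewrite !mxE addrC.
apply: is_derive_mul; first exact/(is_derive_mxP _ _ _ _).1.
exact/(is_derive_mxP _ _ _ _).1.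
Qed.

Lemma bilinear_form_sum n (form : {biscalar 'rV[R]_n}) u v :
  form u v = \sum_i \sum_j u 0 i * v 0 j * form (delta_mx 0 i) (delta_mx 0 j).
Proof.
rewrite [in LHS](row_sum_delta u) linear_sumlz; apply: eq_bigr => i _.
rewrite linearZl_LR /= [in LHS](row_sum_delta v) linear_sumr mulr_sumr; apply: eq_bigr => j _.
by rewrite linearZr_LR /= mulrA.
Qed.

Lemma is_derive_form V n (form : {biscalar 'rV[R]_n}) (a b : V -> 'rV[R]_n) t v a' b' :
  is_derive t v a a' -> is_derive t v b b' ->
  is_derive t v (fun s => form (a s) (b s)) (form a' (b t) + form (a t) b').
Proof.
move=> da db.
have -> : (fun s => form (a s) (b s)) = (fun s =>
    \sum_i \sum_j a s 0 i * b s 0 j * form (delta_mx 0 i) (delta_mx 0 j)).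
  by apply/funext => s; exact: bilinear_form_sum.
rewrite !(bilinear_form_sum form) -big_split/=.
apply: is_derive_bigsum => i; rewrite -big_split/=.
apply: is_derive_bigsum => j; rewrite -mulrDl.
(* The constant factor [form _ _] is given its derivative 0 explicitly, so that [is_derive_mul]
   applies. *)
rewrite -[_ * form _ _]addr0 -[X in _ + X](mulr0 (a t 0 i * b t 0 j)).
apply: is_derive_mul; apply: is_derive_mul; exact/(is_derive_mxP _ _ _ _).1.
Qed.

End Calculus.

(** * Mean value inequality for vector-valued curves *)

Section MeanValue.
Variables (R : realType).

Lemma ler_mx_norm m n (x : 'M[R]_(m, n)) M :
  0 <= M -> (forall i j, `|x i j| <= M) -> `|x| <= M.
Proof.
move=> M0 xM; rewrite [leLHS]/Num.Def.normr/= mx_normrE.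
by apply: bigmax_le => // -[i j] _; exact: xM.
Qed.

Lemma ler_norm_coord m n (x : 'M[R]_(m, n)) i j : `|x i j| <= `|x|.
Proof.
rewrite [leRHS]/Num.Def.normr/= mx_normrE.
exact: (le_bigmax _ (fun k : 'I_m * 'I_n => `|x k.1 k.2|) (i, j)).
Qed.

Lemma MVT_is_derive (f df : R -> R) (a b : R) : a <= b ->
  (forall x, x \in `[a, b]%R -> is_derive x 1 f (df x)) ->
  exists2 c, c \in `[a, b]%R & f b - f a = df c * (b - a).
Proof.
move=> ab dfE; have cf : {within `[a, b], continuous f}.
  by apply: derivable_within_continuous => x xab; case: (dfE x xab).
have df_oo (x : R) : x \in `]a, b[%R -> is_derive x 1 f (df x).
  by move=> xab; apply: dfE; exact: (@subset_itv_oo_cc _ _ a b).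
exact: (MVT_segment ab df_oo cf).
Qed.

(** The norm of a matrix is the maximum of its entries, so the real mean value theorem on each entry
    loses nothing in the constant. *)
Lemma mean_value_le n (c c' : R -> 'rV[R]_n) (I : set R) M :
  is_interval I -> (forall t, I t -> is_derive t 1 c (c' t)) ->
  (forall t, I t -> `|c' t| <= M) ->
  forall s t, I s -> I t -> `|c t - c s| <= M * `|t - s|.
Proof.
move=> itvI dc c'M s t.
wlog st : s t / s <= t => [wlog_st Is It|Is It].
  have [/wlog_st|/ltW /wlog_st] := leP s t; first exact.
  by rewrite distrC (distrC t); exact.
have M0 : 0 <= M by rewrite (le_trans _ (c'M _ Is)).
apply: ler_mx_norm => [|i j]; first by rewrite mulr_ge0.
have Iz z : z \in `[s, t]%R -> I z.
  by rewrite in_itv/= => sz; exact: itvI sz.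
have [z zst E] : exists2 z, z \in `[s, t]%R &
    c t i j - c s i j = c' z i j * (t - s).
  apply: MVT_is_derive (fun s => c s i j) (fun s => c' s i j) _ _ st _ => z zst.
  exact: ((is_derive_mxP _ _ _ _).1 (dc _ (Iz _ zst))).
rewrite !mxE E normrM ler_wpM2r// (le_trans _ (c'M _ (Iz _ zst)))//.
exact: ler_norm_coord.
Qed.

Lemma is_derive0_constant n (c : R -> 'rV[R]_n) (I : set R) :
  is_interval I -> (forall t, I t -> is_derive t 1 c 0) ->
  forall s t, I s -> I t -> c s = c t.
Proof.
move=> itvI dc s t Is It; apply/esym/eqP; rewrite -subr_eq0 -normr_le0.
rewrite -[leRHS](mul0r `|t - s|).
by apply: (mean_value_le itvI dc _ Is It) => z _; rewrite normr0.
Qed.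

End MeanValue.

(** * Symmetry of second derivatives *)

Section Schwarz.
Variables (R : realType) (V : normedModType R).

(** The second difference of [g] over a parallelogram: the mean value theorem is applied along [u],
    then along [v]. The derivative is a separate function [gu], tied to [g] only on that
    parallelogram. *)
Lemma mixed_difference (g gu : V -> R) (u v x : V) (t : R) : 0 <= t ->
  (forall a b, a \in `[0, t]%R -> b \in `[0, t]%R ->
    let y := x + a *: u + b *: v in
    [/\ differentiable g y, differentiable gu y & 'D_u g y = gu y]) ->
  exists a b, [/\ a \in `[0, t]%R, b \in `[0, t]%R &
    g (x + t *: u + t *: v) - g (x + t *: u) - (g (x + t *: v) - g x) =
    'D_v gu (x + a *: u + b *: v) * t * t].
Proof.
move=> t0 H.
have [in0 int] : 0 \in `[0, t]%R /\ t \in `[0, t]%R by rewrite !in_itv/= !lexx t0.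
pose phi a := g (x + a *: u + t *: v) - g (x + a *: u).
have [a a0t phiE] : exists2 a, a \in `[0, t]%R & phi t - phi 0 =
    (gu (x + a *: u + t *: v) - gu (x + a *: u)) * (t - 0).
  apply: (@MVT_is_derive _ phi
    (fun a => gu (x + a *: u + t *: v) - gu (x + a *: u))) => // a a0t.
  apply: is_deriveB.
    have [dg _ <-] := H a t a0t int.
    have -> : (fun a => g (x + a *: u + t *: v)) =
              g \o (fun a => (x + t *: v) + a *: u).
      by apply/funext => s/=; rewrite addrAC.
    rewrite (addrAC x).
    by apply: is_derive_comp; [exact: is_derive_line|rewrite addrAC].
  have [+ _ +] := H a 0 a0t in0; rewrite scale0r addr0 => dg <-.
  by apply: (@is_derive_comp _ _ _ g); [exact: is_derive_line|].
have [b b0t psiE] : exists2 b, b \in `[0, t]%R &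
    gu (x + a *: u + t *: v) - gu (x + a *: u + 0 *: v) =
    'D_v gu (x + a *: u + b *: v) * (t - 0).
  apply: (@MVT_is_derive _ (fun b => gu (x + a *: u + b *: v))
    (fun b => 'D_v gu (x + a *: u + b *: v))) => // b b0t.
  have [_ dgu _] := H a b a0t b0t.
  by apply: (@is_derive_comp _ _ _ gu); [exact: is_derive_line|].
exists a, b; split => //.
move: phiE psiE; rewrite /phi !scale0r !addr0 !subr0 => ->.
by move=> ->.
Qed.

Lemma schwarz_real (g gu gv : V -> R) (u v x : V) :
  (\forall y \near x, [/\ differentiable g y, differentiable gu y & 'D_u g y = gu y]) ->
  (\forall y \near x, [/\ differentiable g y, differentiable gv y & 'D_v g y = gv y]) ->
  {for x, continuous ('D_v gu)} -> {for x, continuous ('D_u gv)} ->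
  'D_v gu x = 'D_u gv x.
Proof.
move=> Hu Hv cu cv; apply/eqP; rewrite -subr_eq0 -normr_le0.
apply/ler_addgt0Pr => e e0; rewrite add0r.
have e20 : 0 < e / 2 by rewrite divr_gt0.
have /cvgrPdist_lt/(_ _ e20) Cu := cu.
have /cvgrPdist_lt/(_ _ e20) Cv := cv.
have [d /= d0 Hd] := (nbhs_ballP _ _).1 (filterI (filterI Hu Hv) (filterI Cu Cv)).
(* With side parameter d / k the parallelogram spanned by t u and t v stays in the ball of radius d;
   the summand 1 keeps k positive when u = v = 0. *)
pose k := `|u| + `|v| + 1.
have k0 : 0 < k by rewrite /k ltr_wpDl// addr_ge0.
pose t := d / k.
have t0 : 0 < t by rewrite divr_gt0.
have near_x a b : a \in `[0, t]%R -> b \in `[0, t]%R ->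
    ball x d (x + a *: u + b *: v).
  rewrite !in_itv/= => /andP[a0 at_] /andP[b0 bt].
  rewrite -ball_normE/= -addrA opprD addrA subrr sub0r normrN.
  rewrite (le_lt_trans (ler_normD _ _))// !normrZ !ger0_norm//.
  rewrite (@le_lt_trans _ _ (t * (`|u| + `|v|)))//.
    by rewrite mulrDr lerD// ler_wpM2r.
  by rewrite /t mulrAC ltr_pdivrMr// ltr_pM2l// /k ltrDl.
have [a [b [a0t b0t E1]]] := @mixed_difference g gu u v x t (ltW t0)
  (fun a b ha hb => (Hd _ (near_x a b ha hb)).1.1).
have near_x' r s : r \in `[0, t]%R -> s \in `[0, t]%R ->
    ball x d (x + r *: v + s *: u).
  by move=> ? ?; rewrite addrAC; exact: near_x.
have [a' [b' [a0t' b0t' E2]]] := @mixed_difference g gv v u x t (ltW t0)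
  (fun r s hr hs => (Hd _ (near_x' r s hr hs)).1.2).
(* Both sides times t^2 equal the same second difference, which is symmetric in [u] and [v]. *)
have E : 'D_v gu (x + a *: u + b *: v) = 'D_u gv (x + a' *: v + b' *: u).
  apply: (@mulIf _ t); first by rewrite gt_eqF.
  apply: (@mulIf _ t); first by rewrite gt_eqF.
  by rewrite -E1 -E2 (addrAC x); ring.
have [_ [/= h1 _]] := Hd _ (near_x a b a0t b0t).
have [_ [_ /= h2]] := Hd _ (near_x' a' b' a0t' b0t').
rewrite (splitr e) (@le_trans _ _ (`|'D_v gu x - 'D_v gu (x + a *: u + b *: v)| +
  `|'D_u gv x - 'D_u gv (x + a' *: v + b' *: u)|))//; last first.
  by apply: lerD; exact: ltW.
by rewrite (distrC ('D_u gv x)) E -[leLHS]/`|_ - _| (le_trans _ (ler_normD _ _))// addrA subrK.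
Qed.

Lemma derive_coord n (f : V -> 'rV[R]_n) x v i j : differentiable f x ->
  'D_v (fun y => f y i j) x = 'D_v f x i j.
Proof. by move=> df; rewrite [in RHS]derive_mx ?mxE//; exact: diff_derivable. Qed.

Lemma differentiable_coord_comp n (f : V -> 'rV[R]_n) x i j :
  differentiable f x -> differentiable (fun y => f y i j) x.
Proof.
move=> df; apply: (@differentiable_comp _ _ _ _ f (fun N : 'rV[R]_n => N i j)) => //.
exact: differentiable_coord.
Qed.

(** Reduction to real functions by coordinates; the second derivatives are continuous because
    smoothness makes them differentiable. *)
Lemma smooth_on_schwarz n (A : set V) (f : V -> 'rV[R]_n) u v x :
  open A -> smooth_on A f -> A x -> 'D_v ('D_u f) x = 'D_u ('D_v f) x.
Proof.
move=> oA sf Ax.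
have H w : \forall y \near x, forall i j, [/\ differentiable (fun y => f y i j) y,
    differentiable (fun y => 'D_w f y i j) y &
    'D_w (fun y => f y i j) y = 'D_w f y i j].
  near=> y; have Ay : A y by near: y; exact: open_nbhs_nbhs.
  move=> i j; have df := smooth_on_differentiable sf Ay.
  split; [exact: differentiable_coord_comp| |exact: derive_coord].
  apply: differentiable_coord_comp.
  exact: (smooth_on_differentiable (smooth_on_derive w sf)).
have C w z i j : {for x, continuous ('D_w (fun y => 'D_z f y i j))}.
  have cz : {for x, continuous (fun y => 'D_w ('D_z f) y i j)}.
    apply: differentiable_continuous; apply: differentiable_coord_comp.
    exact: (smooth_on_differentiable (smooth_on_derive w (smooth_on_derive z sf))).
  apply: cvg_trans; last first.
    rewrite derive_coord; first exact: cz.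
    exact: (smooth_on_differentiable (smooth_on_derive z sf)).
  apply: near_eq_cvg; near=> y; rewrite derive_coord//.
  apply: (smooth_on_differentiable (smooth_on_derive z sf)).
  by near: y; exact: open_nbhs_nbhs.
apply/matrixP => i j.
have D w := smooth_on_differentiable (smooth_on_derive w sf) Ax.
have E : 'D_v (fun y => 'D_u f y i j) x = 'D_u (fun y => 'D_v f y i j) x.
  apply: (@schwarz_real (fun y => f y i j)); [| |exact: C|exact: C].
  - by apply: filterS (H u) => y; exact.
  - by apply: filterS (H v) => y; exact.
exact: (etrans (esym (derive_coord v i j (D u)))
  (etrans E (derive_coord u i j (D v)))).
Unshelve. all: by end_near. Qed.

End Schwarz.

(** * Local solutions of ordinary differential equations *)

Section Picard.
Variables (R : realType) (n : nat).
Notation V := 'rV[R]_n.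

Lemma exists_primitive (g : R -> R) (b : R) : continuous g ->
  exists F : R -> R, F b = 0 /\ forall t : R, `|t - b| < 1 -> is_derive t 1 F (g t).
Proof.
move=> cg; pose F0 x := (\int[@lebesgue_measure R]_(t in `[b - 1, x]) g t)%R.
exists (fun x => F0 x - F0 b); split; first by rewrite subrr.
move=> t; rewrite ltr_norml => /andP[bt tb].
have tu : t < b + 1 by lra.
have at_ : b - 1 < t by lra.
have gi : (@lebesgue_measure R).-integrable `[b - 1, b + 1] (EFin \o g).
  apply: continuous_compact_integrable; first exact: segment_compact.
  exact: continuous_subspaceT.
have [dF FE] := continuous_FTC1_closed tu gi at_ (cg t).
have dF0 : is_derive t 1 F0 (g t).
  by apply: DeriveDef; [exact: dF|rewrite -derive1E].
apply: (@is_derive_eq _ _ _ (F0 - cst (F0 b))); exact: subr0.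
Qed.

Lemma exists_primitive_vector (g : R -> V) (b : R) : continuous g ->
  exists F : R -> V, F b = 0 /\ forall t : R, `|t - b| < 1 -> is_derive t 1 F (g t).
Proof.
move=> cg; have cgj j : continuous (fun t => g t 0 j).
  move=> t; apply: (@continuous_comp _ _ _ g (fun M : V => M 0 j)); first exact: cg.
  exact: coord_continuous.
pose F t : V := \row_j sval (cid (exists_primitive b (cgj j))) t.
exists F; split=> [|t tb].
  by apply/rowP => j; rewrite !mxE; case: cid => f [].
apply/is_derive_mxP => i j; rewrite ord1.
have -> : (fun s => F s 0 j) = sval (cid (exists_primitive b (cgj j))).
  by apply/funext => s; rewrite mxE.
case: (cid (exists_primitive b (cgj j))) => f [f0 df].
exact: df.
Qed.

(** The error 2 D / 2^k is the tail of the geometric series. Hence u_k minus the error increases,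
    u_k plus the error decreases, and the supremum of the lower ends lies in all these nested
    intervals. *)
Lemma geometric_increments_limit (u : nat -> R) D :
  (forall k, `|u k.+1 - u k| <= D / 2 ^+ k) ->
  exists l, forall k, `|u k - l| <= 2 * D / 2 ^+ k.
Proof.
move=> uD; pose err k := 2 * D / 2 ^+ k.
have errS k : err k = err k.+1 + D / 2 ^+ k.
  rewrite /err exprS; field; exact: expf_neq0.
have uD' k : u k - D / 2 ^+ k <= u k.+1 <= u k + D / 2 ^+ k.
  by move: (uD k); rewrite ler_norml => /andP[? ?]; apply/andP; split; lra.
have D0 : 0 <= D by have := uD 0%N; rewrite expr0 divr1 => /(le_trans _); exact.
have err0 k : 0 <= err k by rewrite /err divr_ge0// ?mulr_ge0// exprn_ge0.
pose a k := u k - err k; pose c k := u k + err k.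
have aS : forall i k, a k <= a (k + i)%N.
  elim=> [|i IH] k; first by rewrite addn0.
  apply: le_trans (IH k) _; rewrite addnS /a (errS (k + i)%N).
  by have /andP[? ?] := uD' (k + i)%N; lra.
have cS : forall i k, c (k + i)%N <= c k.
  elim=> [|i IH] k; first by rewrite addn0.
  apply: le_trans _ (IH k); rewrite addnS /c (errS (k + i)%N).
  by have /andP[? ?] := uD' (k + i)%N; lra.
have ac i k : a i <= c k.
  apply: le_trans (aS k i) _; apply: le_trans _ (cS i k).
  by rewrite addnC /a /c; have := err0 (k + i)%N; lra.
have hs : has_sup (range a).
  by split; [exists (a 0%N), 0%N|exists (c 0%N) => _ [i _ <-]].
exists (sup (range a)) => k; rewrite ler_norml; apply/andP; split.
  have : sup (range a) <= c k.
    by apply: sup_le_ub; [exists (a 0%N), 0%N|move=> _ [i _ <-]].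
  by rewrite -/(err k) /c; lra.
have : a k <= sup (range a) by apply: ub_le_sup; [exact: hs.2|exists k].
by rewrite -/(err k) /a; lra.
Qed.

Lemma geometric_increments_limit_vector (u : nat -> V) D :
  (forall k, `|u k.+1 - u k| <= D / 2 ^+ k) ->
  exists l, forall k, `|u k - l| <= 2 * D / 2 ^+ k.
Proof.
move=> uD.
have uDj j k : `|u k.+1 0 j - u k 0 j| <= D / 2 ^+ k.
  apply: le_trans (uD k); apply: le_trans (ler_norm_coord _ 0 j).
  by rewrite !mxE.
exists (\row_j sval (cid (geometric_increments_limit (uDj j)))) => k.
have D0 : 0 <= D by have := uD 0%N; rewrite expr0 divr1 => /(le_trans _); exact.
apply: ler_mx_norm; first by rewrite divr_ge0// ?mulr_ge0// exprn_ge0.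
by move=> i j; rewrite !mxE ord1; case: cid.
Qed.

Lemma small_geometric (D eps : R) : 0 < eps -> exists k, D / 2 ^+ k < eps.
Proof.
move=> eps0; exists (Num.bound (D / eps)); rewrite ltr_pdivrMr ?exprn_gt0//.
by rewrite -ltr_pdivrMl// mulrC; exact: upper_nthrootP.
Qed.

Lemma lipschitz_continuous (W W' : normedModType R) (f : W -> W') K :
  (forall x y, `|f x - f y| <= K * `|x - y|) -> continuous f.
Proof.
move=> fK x; apply/cvgrPdist_lt => eps eps0.
have K0 : 0 < `|K| + 1 by rewrite ltr_wpDl.
have d0 : 0 < eps / (`|K| + 1) by rewrite divr_gt0.
near=> y; apply: le_lt_trans (fK x y) _.
apply: (@le_lt_trans _ _ ((`|K| + 1) * `|x - y|)).
  by rewrite ler_wpM2r//; have := ler_norm K; lra.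
rewrite mulrC -ltr_pdivlMr//; near: y.
Unshelve. all: by end_near. Qed.

(** For r >= 0, the 1-Lipschitz retraction of the line onto [c - r, c + r]. It turns local data into
    global data, both in time and in each space coordinate. *)
Definition clamp (c r t : R) := Num.max (c - r) (Num.min (c + r) t).

Lemma clamp_lipschitz c r s t : `|clamp c r s - clamp c r t| <= `|s - t|.
Proof.
rewrite ler_norml /clamp !maxEle !minEle.
have h1 := ler_norm (s - t); have h2 := ler_norm (t - s).
rewrite distrC in h2; have h3 := normr_ge0 (s - t).
by case: (leP (c + r) s) => ?; case: (leP (c + r) t) => ?;
  case: (leP (c - r) (c + r)) => ?; case: (leP (c - r) s) => ?;
  case: (leP (c - r) t) => ?; apply/andP; split; lra.
Qed.

Lemma clamp_dist c r t : 0 <= r -> `|clamp c r t - c| <= r.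
Proof.
move=> r0; rewrite ler_norml /clamp maxEle minEle.
by case: (leP (c + r) t) => ?; case: (leP (c - r) (c + r)) => ?;
  case: (leP (c - r) t) => ?; apply/andP; split; lra.
Qed.

Lemma clamp_id c r t : `|t - c| <= r -> clamp c r t = t.
Proof.
rewrite ler_norml /clamp maxEle minEle => /andP[? ?].
by case: (leP (c + r) t) => ?; case: (leP (c - r) (c + r)) => ?;
  case: (leP (c - r) t) => ?; lra.
Qed.

Lemma near_ball (b r t : R) : `|t - b| < r -> \forall s \near t, `|s - b| < r.
Proof.
move=> tb; have r0 : 0 < r by exact: le_lt_trans tb.
have : nbhs t (ball b r).
  apply: open_nbhs_nbhs; split; first exact: ball_open.
  by rewrite -ball_normE /= distrC.
by apply: filterS => s; rewrite -ball_normE /= distrC.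
Qed.

Lemma ball_is_interval (b r : R) : is_interval [set t | `|t - b| < r].
Proof.
move=> s t /=; rewrite !ltr_norml => /andP[? ?] /andP[? ?] z /andP[? ?].
by rewrite ltr_norml; apply/andP; split; lra.
Qed.

(* The time variable is clamped to [b - h, b + h] so that the iterates are
   continuous functions on the whole line. *)
Lemma picard (f : R -> V -> V) (b : R) (y0 : V) (L M : R) :
  (forall y : R -> V, continuous y -> continuous (fun t => f t (y t))) ->
  (forall t y z, `|t - b| < 1 -> `|f t y - f t z| <= L * `|y - z|) ->
  (forall t y, `|t - b| < 1 -> `|f t y| <= M) ->
  exists2 h, 0 < h & exists y : R -> V, y b = y0 /\
    forall t : R, `|t - b| < h -> is_derive t 1 y (f t (y t)).
Proof.
move=> fc fL fM.
wlog L0 : L fL / 0 <= L.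
  move=> wlogL; apply: (wlogL `|L|) => // t y z tb.
  by apply: le_trans (fL t y z tb) _; rewrite ler_wpM2r// ler_norm.
have M0 : 0 <= M.
  by apply: le_trans (fM b y0 _) => //; rewrite subrr normr0.
(* [L * h <= 1/2] makes the Picard operator contract by 1/2, and L + 1 in place of L also gives h <
   1, inside the range where the primitives are valid. *)
pose h := (2 * (L + 1))^-1.
have h0 : 0 < h by rewrite invr_gt0 mulr_gt0// ltr_wpDl.
have hL1 : h * (2 * (L + 1)) = 1.
  by rewrite mulVf// mulf_neq0// gt_eqF// ltr_wpDl.
have hL : L * h <= 2^-1 by nra.
have h1 : h < 1 by nra.
exists h => //.
(* A primitive operator defined on all functions, with a dummy value on discontinuous ones, so that
   [choice] applies. *)
have prim (g : R -> V) : exists F : R -> V, continuous g ->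
    F b = 0 /\ forall t : R, `|t - b| < 1 -> is_derive t 1 F (g t).
  have [cg|ncg] := pselect (continuous g); last by exists (fun=> 0).
  by have [F FP] := exists_primitive_vector b cg; exists F.
have [Pr PrP] := choice prim.
pose fy (y : R -> V) t := f t (y t).
pose Phi y t := y0 + Pr (fy y) (clamp b h t).
have clb t : `|clamp b h t - b| < 1.
  exact: le_lt_trans (clamp_dist _ _ (ltW h0)) h1.
have bb : `|b - b| < 1 by rewrite subrr normr0.
have cb : clamp b h b = b by apply: clamp_id; rewrite subrr normr0 ltW.
have Phi_cont y : continuous y -> continuous (Phi y).
  move=> cy t; have [_ dP] := PrP _ (fc _ cy).
  apply: cvgD; first exact: cvg_cst.
  apply: (@continuous_comp _ _ _ (clamp b h) (Pr (fy y))).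
    by apply: (@lipschitz_continuous _ _ _ 1) => s s'; rewrite mul1r clamp_lipschitz.
  apply: differentiable_continuous; apply/derivable1_diffP.
  by have [] := dP _ (clb t).
have Phi_contr y z D : continuous y -> continuous z ->
    (forall t, `|y t - z t| <= D) -> forall t, `|Phi y t - Phi z t| <= D / 2.
  move=> cy cz yzD t.
  have [Py0 dPy] := PrP _ (fc _ cy); have [Pz0 dPz] := PrP _ (fc _ cz).
  have D0 : 0 <= D by exact: le_trans (yzD b).
  have dd s : `|s - b| < 1 ->
      is_derive s 1 (fun s => Pr (fy y) s - Pr (fy z) s) (fy y s - fy z s).
    by move=> sb; apply: is_deriveB; [exact: dPy|exact: dPz].
  have le_d s : `|s - b| < 1 -> `|fy y s - fy z s| <= L * D.
    move=> sb; apply: le_trans (fL s _ _ sb) _.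
    by rewrite ler_wpM2l.
  have := mean_value_le (@ball_is_interval b 1) dd le_d bb (clb t).
  rewrite Py0 Pz0 subrr subr0 /Phi opprD addrACA subrr add0r => /le_trans; apply.
  apply: (@le_trans _ _ (L * D * h)).
    by apply: ler_wpM2l; [rewrite mulr_ge0|exact: clamp_dist (ltW h0)].
  by rewrite mulrAC mulrC ler_wpM2l.
pose Y k := iter k Phi (cst y0).
have Yc k : continuous (Y k).
  by elim: k => [|k IH]; [exact: cst_continuous|exact: Phi_cont].
have Y1 t : `|Y 1%N t - Y 0%N t| <= M.
  have [P0 dP] := PrP _ (fc _ (Yc 0%N)).
  have := mean_value_le (@ball_is_interval b 1) dP (fun s => fM s _) bb (clb t).
  rewrite P0 subr0 => H; rewrite /Y /= /Phi addrAC subrr add0r.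
  apply: le_trans H _; rewrite -[leRHS]mulr1 ler_wpM2l//.
  exact: ltW (clb t).
have YS k : forall t, `|Y k.+1 t - Y k t| <= M / 2 ^+ k.
  elim: k => [|k IH] t; first by rewrite expr0 divr1.
  by rewrite exprSr invfM mulrA;
    exact: (Phi_contr (Y k.+1) (Y k) _ (Yc _) (Yc _) IH t).
have [y yP] := choice (fun t => geometric_increments_limit_vector (YS^~ t)).
have yc : continuous y.
  move=> t; apply/cvgrPdist_lt => eps eps0.
  have eps3 : 0 < eps / 3 by rewrite divr_gt0.
  have [k kP] := small_geometric (2 * M) eps3.
  have /cvgrPdist_lt/(_ _ eps3) Yk := Yc k t.
  apply: filterS Yk => s Yts.
  have e1 := le_lt_trans (yP t k) kP; have e2 := le_lt_trans (yP s k) kP.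
  rewrite distrC in e1.
  have -> : y t - y s = (y t - Y k t) + (Y k t - Y k s) + (Y k s - y s).
    by rewrite !subrKA.
  apply: le_lt_trans (ler_normD _ _) _.
  apply: le_lt_trans (lerD (ler_normD _ _) (lexx _)) _; lra.
(* The iterate [Y k.+1] is [Phi (Y k)], hence close to [Phi y] by contraction, and it is also close
   to [y]. *)
have yE t : y t = Phi y t.
  apply/eqP; rewrite -subr_eq0 -normr_le0; apply/ler_addgt0Pr => eps eps0.
  rewrite add0r; have eps2 : 0 < eps / 2 by rewrite divr_gt0.
  have [k kP] := small_geometric (2 * M) eps2.
  have := Phi_contr _ _ _ (Yc k) yc (yP^~ k) t.
  have := yP t k.+1; rewrite -/(Y k.+1 t) => e1 e2.
  have -> : y t - Phi y t = (y t - Y k.+1 t) + (Y k.+1 t - Phi y t).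
    by rewrite subrKA.
  apply: le_trans (ler_normD _ _) _; rewrite distrC.
  have e3 : 2 * M / 2 ^+ k.+1 = 2 * M / 2 ^+ k / 2 by rewrite exprSr invfM mulrA.
  rewrite e3 in e1.
  have e4 : `|Y k.+1 t - Phi y t| <= 2 * M / 2 ^+ k / 2 by exact: e2.
  lra.
have [P0 dP] := PrP _ (fc _ yc).
exists y; split=> [|t tb]; first by rewrite yE /Phi cb P0 addr0.
have ntb : \forall s \near t, `|s - b| < h.
  exact: near_ball.
have : is_derive t 1 (fun s => y0 + Pr (fy y) s) (f t (y t)).
  have := is_deriveD (is_derive_cst y0 t (1 : R)) (dP t (lt_trans tb h1)).
  by rewrite add0r.
apply: near_eq_is_derive; apply: filterS ntb => s sb.
by rewrite yE /Phi clamp_id// ltW.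
Qed.

End Picard.

(** * Differential equations linear in a prescribed control *)

Section LinearControl.
Variables (R : realType) (n : nat).
Notation V := 'rV[R]_n.
Notation "''e_' i" := (delta_mx 0 i : V) (at level 8, i at level 2).

Lemma continuous_bounded_ball (P : R -> V) b : continuous P ->
  exists2 C, 0 <= C & forall t, `|t - b| < 1 -> `|P t| <= C.
Proof.
move=> cP; have b1 : b - 1 <= b + 1 by lra.
have cN : {within `[b - 1, b + 1], continuous (fun t => `|P t|)}.
  apply: continuous_subspaceT => t.
  by apply: (@continuous_comp _ _ _ P (fun v : V => `|v|)); [exact: cP|exact: norm_continuous].
have [c _ cM] := EVT_max b1 cN.
exists `|P c| => // t; rewrite ltr_norml => /andP[? ?]; apply: cM.
by rewrite in_itv/=; apply/andP; split; lra.
Qed.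

Lemma continuous_bigsum m (h : 'I_m -> R -> V) (t : R) :
  (forall i, {for t, continuous (h i)}) ->
  {for t, continuous (fun s => \sum_i h i s)}.
Proof.
elim: m h => [|m IH] h ch.
  have -> : (fun s => \sum_(i < 0) h i s) = cst 0.
    by apply/funext => s; rewrite big_ord0.
  exact: cst_continuous.
have -> : (fun s => \sum_(i < m.+1) h i s) =
    (fun s => \sum_(i < m) h (widen_ord (leqnSn m) i) s) + h ord_max.
  by apply/funext => s; rewrite big_ord_recr.
by apply: continuousD; [apply: IH => i|]; exact: ch.
Qed.

Variables (A : V -> {linear V -> V}) (x0 : V).
Hypothesis A_diff : forall j, \forall x \near x0, differentiable (fun y => A y 'e_j) x.
Hypothesis A_C1 : forall i j, {for x0, continuous ('D_('e_i) (fun y => A y 'e_j))}.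

Lemma derive_row_sum_le (g : V -> V) (K : 'I_n -> R) x w : differentiable g x ->
  (forall i, `|'D_('e_i) g x| <= K i) -> `|'D_w g x| <= (\sum_i K i) * `|w|.
Proof.
move=> dg gK; rewrite (deriveE w dg) row_linear_sum mulr_suml.
apply: le_trans (ler_norm_sum _ _ _) _; apply: ler_sum => i _.
rewrite normrZ mulrC; apply: ler_pM => //; last exact: ler_norm_coord.
by rewrite -(deriveE _ dg).
Qed.

(** Continuous partial derivatives are bounded near [x0], and the mean value inequality along
    segments turns the bound into a Lipschitz constant. Summing over j gives one constant for all
    basis vectors. *)
Lemma local_lipschitz : exists r K, [/\ 0 < r, 0 <= K &
  (forall j x, `|x - x0| <= r -> differentiable (fun y => A y 'e_j) x) /\
  (forall j x z, `|x - x0| <= r -> `|z - x0| <= r ->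
    `|A x 'e_j - A z 'e_j| <= K * `|x - z|)].
Proof.
pose D i j := 'D_('e_i) (fun y => A y 'e_j).
pose K i j := `|D i j x0| + 1.
have N : \forall x \near x0, forall i j,
    differentiable (fun y => A y 'e_j) x /\ `|D i j x| <= K i j.
  near=> x => i j; move: i j; near: x.
  apply: filter_forall => i; apply: filter_forall => j.
  apply: filterI; first exact: A_diff.
  have /cvgrPdist_lt/(_ _ (@ltr01 R)) := @A_C1 i j.
  apply: filterS => x Dx; rewrite /K -lerBlDl.
  by apply: le_trans (lerB_dist _ _) _; rewrite distrC ltW.
have [d /= d0 Hd] := (nbhs_ballP _ _).1 N.
have Hd' x : `|x - x0| <= d / 2 -> forall i j,
    differentiable (fun y => A y 'e_j) x /\ `|D i j x| <= K i j.
  move=> xd; apply: Hd; rewrite -ball_normE /= distrC.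
  by apply: le_lt_trans xd _; lra.
have K0 i j : 0 <= K i j by rewrite addr_ge0.
exists (d / 2), (\sum_j \sum_i K i j); split.
- by rewrite divr_gt0.
- by apply: sumr_ge0 => j _; apply: sumr_ge0.
split=> [j x /Hd'/(_ j j)[]//|j x z xr zr].
have seg s : s \in `[0, 1]%R -> `|z + s *: (x - z) - x0| <= d / 2.
  rewrite in_itv/= => /andP[s0 s1].
  have -> : z + s *: (x - z) - x0 = (1 - s) *: (z - x0) + s *: (x - x0).
    by apply/rowP => k; rewrite !mxE; ring.
  apply: le_trans (ler_normD _ _) _; rewrite !normrZ !ger0_norm ?subr_ge0//.
  apply: (@le_trans _ _ ((1 - s) * (d / 2) + s * (d / 2))); last by lra.
  by apply: lerD; apply: ler_wpM2l; rewrite ?subr_ge0.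
have dg (s : R) : `[0, 1]%classic s -> is_derive s 1 (fun s => A (z + s *: (x - z)) 'e_j)
    ('D_(x - z) (fun y => A y 'e_j) (z + s *: (x - z))).
  move=> s01; have [dA _] := Hd' _ (seg s s01) j j.
  exact: (@is_derive_comp _ _ _ (fun y => A y 'e_j)) (is_derive_line z (x - z) s) dA.
have dgK (s : R) : `[0, 1]%classic s ->
    `|'D_(x - z) (fun y => A y 'e_j) (z + s *: (x - z))| <= (\sum_i K i j) * `|x - z|.
  move=> s01; apply: derive_row_sum_le; first by have [] := Hd' _ (seg s s01) j j.
  by move=> i; have [] := Hd' _ (seg s s01) i j.
have i01 : is_interval `[(0:R), 1]%classic by exact: interval_is_interval.
have in0 : `[(0:R), 1]%classic 0 by rewrite /= in_itv/= lexx ler01.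
have in1 : `[(0:R), 1]%classic 1 by rewrite /= in_itv/= lexx ler01.
have := mean_value_le i01 dg dgK in0 in1.
have -> : z + 1 *: (x - z) = x by rewrite scale1r addrC subrK.
have -> : z + 0 *: (x - z) = z by rewrite scale0r addr0.
rewrite subr0 normr1 mulr1 => /le_trans; apply.
apply: ler_wpM2r => //; rewrite [leRHS](bigD1 j)//= lerDl.
by apply: sumr_ge0 => k _; apply: sumr_ge0.
Unshelve. all: by end_near. Qed.

(** Retracting the space variable to a small ball around [x0] makes the right-hand side globally
    Lipschitz and bounded, as [picard] demands. Near time b the solution is still inside that ball,
    where the retraction is the identity. *)
Lemma linear_control_ode (P : R -> V) (b : R) : continuous P ->
  exists2 h, 0 < h & exists y : R -> V, y b = x0 /\
    forall t : R, `|t - b| < h -> is_derive t 1 y (A (y t) (P t)).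
Proof.
move=> cP; have [r [K [r0 K0 [Adiff Alip]]]] := local_lipschitz.
have [C C0 PC] := continuous_bounded_ball b cP.
(* In the maximum norm a closed ball is a cube, so clamping each coordinate is a 1-Lipschitz
   retraction onto it. *)
pose cl (x : V) : V := \row_j clamp (x0 0 j) r (x 0 j).
have clr x : `|cl x - x0| <= r.
  apply: ler_mx_norm => [|i j]; first exact: ltW.
  by rewrite !mxE ord1; exact: clamp_dist (ltW r0).
have cl_lip x z : `|cl x - cl z| <= `|x - z|.
  apply: ler_mx_norm => // i j; rewrite !mxE.
  apply: le_trans (clamp_lipschitz _ _ _ _) _.
  by apply: le_trans (ler_norm_coord (x - z) 0 j); rewrite !mxE.
have cl_id x : `|x - x0| <= r -> cl x = x.
  move=> xr; apply/rowP => j; rewrite mxE clamp_id//.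
  by apply: le_trans xr; apply: le_trans (ler_norm_coord _ 0 j); rewrite !mxE.
pose f t x := A (cl x) (P t).
have fE t x : f t x = \sum_j P t 0 j *: A (cl x) 'e_j by exact: row_linear_sum.
have PCj t j : `|t - b| < 1 -> `|P t 0 j| <= C.
  by move=> tb; apply: le_trans (ler_norm_coord _ _ _) (PC t tb).
have fc (y : R -> V) : continuous y -> continuous (fun t => f t (y t)).
  move=> cy; have -> : (fun t => f t (y t)) =
      (fun t => \sum_j P t 0 j *: A (cl (y t)) 'e_j) by apply/funext => t.
  move=> t; apply: continuous_bigsum => j; apply: cvgZ.
    by apply: (@continuous_comp _ _ _ P (fun M : V => M 0 j));
      [exact: cP|exact: coord_continuous].
  apply: (@continuous_comp _ _ _ (cl \o y) (fun x => A x 'e_j)).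
    apply: continuous_comp; first exact: cy.
    by apply: (@lipschitz_continuous _ _ _ _ 1) => x z; rewrite mul1r.
  exact: differentiable_continuous (Adiff j _ (clr (y t))).
have fL t x z : `|t - b| < 1 ->
    `|f t x - f t z| <= (\sum_(j < n) C * K) * `|x - z|.
  move=> tb; rewrite !fE -sumrB mulr_suml.
  apply: le_trans (ler_norm_sum _ _ _) _; apply: ler_sum => j _.
  rewrite -scalerBr normrZ -mulrA; apply: ler_pM => //; first exact: PCj.
  apply: le_trans (Alip _ _ _ (clr x) (clr z)) _.
  by apply: ler_wpM2l.
have fM t x : `|t - b| < 1 ->
    `|f t x| <= \sum_j C * (`|A x0 'e_j| + K * r).
  move=> tb; rewrite fE.
  apply: le_trans (ler_norm_sum _ _ _) _; apply: ler_sum => j _.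
  rewrite normrZ; apply: ler_pM => //; first exact: PCj.
  rewrite -[A (cl x) _](subrK (A x0 'e_j)) addrC.
  apply: le_trans (ler_normD _ _) _; apply: lerD => //.
  have x0r : `|x0 - x0| <= r by rewrite subrr normr0 ltW.
  by apply: le_trans (Alip _ _ _ (clr x) x0r) _; apply: ler_wpM2l.
have [h h0 [y [yb dy]]] := picard x0 fc fL fM.
have yr : \forall t \near b, `|y t - x0| < r.
  have cy : {for b, continuous y}.
    apply: differentiable_continuous; apply/derivable1_diffP.
    by have [] := dy b; rewrite ?subrr ?normr0.
  have /cvgrPdist_lt/(_ _ r0) := cy; rewrite yb.
  by apply: filterS => t; rewrite distrC.
have [d /= d0 Hd] := (nbhs_ballP _ _).1 yr.
exists (Num.min d h); first by rewrite lt_min d0 h0.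
exists y; split => // t; rewrite lt_min => /andP[td th].
have -> : A (y t) (P t) = f t (y t); last exact: dy.
rewrite /f cl_id//; apply: ltW; apply: Hd.
by rewrite -ball_normE /= distrC.
Qed.

End LinearControl.

(** * The algebra of the U-tensor *)

Section Nilpotent.
Variable F : numFieldType.

(** Write E = C R with C of full column rank and R of full row rank. Cancelling both in C R C R = C
    R leaves R C = 1 of size rank E, and tr (C R) = tr (R C). *)
Lemma mxtrace_idempotent n (E : 'M[F]_n) : E *m E = E -> \tr E = (\rank E)%:R.
Proof.
move=> EE; rewrite -{1}(mulmx_base E) mxtrace_mulC.
suff -> : row_base E *m col_base E = 1%:M by rewrite mxtrace1.
apply: (row_free_inj (row_base_free E)); apply: (row_full_inj (col_base_full E)).
have CR : col_base E *m row_base E = E by exact: mulmx_base.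
have -> : 1%:M *m row_base E = row_base E by rewrite mul1mx.
have H : (col_base E *m row_base E) *m (col_base E *m row_base E) =
    col_base E *m row_base E by rewrite CR.
by rewrite -[RHS]H !mulmxA.
Qed.

(* Fitting: [A] acts invertibly on the range of an idempotent polynomial in
   [A] without constant term, whose rank is its trace, hence zero. *)
Lemma trace_nilpotent n (A : 'M[F]_n.+1) :
  (forall p, \tr (A * horner_mx A p) = 0) -> A ^+ n.+1 = 0.
Proof.
move=> trA; set p := char_poly A.
have p0 : p != 0 by rewrite monic_neq0// char_poly_monic.
have pA : horner_mx A p = 0 by exact: Cayley_Hamilton.
have [m [q q0 pE]] := multiplicity_XsubC p 0.
rewrite p0 /= in q0; rewrite polyC0 subr0 in pE.
(* The exponent is m + 1 rather than m so that the polynomial defining [E] has a factor 'X even when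
   m = 0; the trace hypothesis covers only such polynomials. *)
have /Bezout_eq1_coprimepP[[u v] /= uv] : coprimep q ('X^(m.+1)).
  apply: coprimep_expr; rewrite -['X]subr0 -(polyC0 F).
  by rewrite coprimep_XsubC.
set E := horner_mx A (v * 'X^(m.+1)).
have Eidem : E *m E = E.
  rewrite -[RHS]mulr1 -(rmorph1 (horner_mx A)) -uv rmorphD /= mulrDr.
  rewrite -/E -rmorphM (_ : _ * (u * q) = v * u * 'X * p); last first.
    by rewrite pE exprS; ring.
  by rewrite rmorphM /= pA mulr0 add0r.
have E0 : E = 0.
  apply/eqP; rewrite -mxrank_eq0 -(pnatr_eq0 F) -(mxtrace_idempotent Eidem).
  have -> : E = A * horner_mx A (v * 'X^m).
    by rewrite -[X in X * _](horner_mx_X A) -rmorphM /E exprS; congr horner_mx; ring.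
  by rewrite trA.
(* With E = 0 the Bezout identity reads u(A) q(A) = 1, so A^m = u(A) q(A) A^m = u(A) p(A) = 0. *)
have Am : A ^+ m = 0.
  rewrite -[LHS]mulr1 -(rmorph1 (horner_mx A)) -uv rmorphD /= -/E E0 addr0.
  rewrite -[X in X ^+ m](horner_mx_X A) -rmorphXn -rmorphM.
  by rewrite (_ : _ * (u * q) = u * p) ?rmorphM /= ?pA ?mulr0// pE; ring.
have mn : (m <= n.+1)%N.
  have : 'X^m %| p by rewrite pE dvdp_mull.
  by move=> /(dvdp_leq p0); rewrite size_polyXn size_char_poly.
have -> : A ^+ n.+1 = A ^+ (n.+1 - m) * A ^+ m.
  by rewrite -exprD subnK.
by rewrite Am mulr0.
Qed.

(** [S] may lack the identity matrix, but A p(A) always lies in it, which is why [trace_nilpotent]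
    speaks of these traces only. Dimension 0 is separate because square matrices form a ring here
    only in size n + 1. *)
Lemma traceless_subalgebra_nilpotent n (S : set 'M[F]_n) (A : 'M[F]_n) :
  (forall k M N, S M -> S N -> S (k *: M + N)) ->
  (forall M N, S M -> S N -> S (M *m N)) ->
  (forall M, S M -> \tr M = 0) -> S A ->
  forall v : 'rV[F]_n, iter n (mulmx^~ A) v = 0.
Proof.
case: n S A => [|n] S A SP SM trS SA v; first by apply/rowP => -[].
have S0 : S 0 by rewrite -(addNr A) -scaleN1r; exact: SP.
have iterE k : iter k (mulmx^~ A) v = v *m A ^+ k.
  by elim: k => [|k IH]; rewrite ?expr0 ?mulmx1// exprSr mulmxA -IH.
rewrite iterE trace_nilpotent ?mulmx0// => p; apply: trS.
elim/poly_ind: p => [|p c IH]; first by rewrite rmorph0 mulr0.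
rewrite rmorphD rmorphM /= horner_mx_X horner_mx_C mulrDr mulrA addrC.
by rewrite -[_ * c%:M]/(A *m c%:M) mul_mx_scalar; apply: SP => //; exact: SM.
Qed.

End Nilpotent.

(** * Commutative associative nilpotent algebras and x' = - x^2 *)

Section CommutativeAssociative.
Variables (R : realType) (n : nat).
Notation V := 'rV[R]_n.
Variable U : V -> V -> V.
Hypothesis Ulin : forall X, linear (U X).
Hypothesis Uc : forall X Y, U X Y = U Y X.
Hypothesis Ua : associative_U U.

Definition mulU (X : V) : {linear V -> V} :=
  HB.pack (U X) (GRing.isLinear.Build _ _ _ _ (U X) (Ulin X)).

Lemma mulUE X Y : mulU X Y = U X Y. Proof. by []. Qed.

Definition mulU_mx (X : V) : 'M[R]_n := lin1_mx (mulU X).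

Lemma mulU_mxE X v : v *m mulU_mx X = U X v.
Proof. by rewrite mul_rV_lin1. Qed.

(** Makes the multiplication matrices closed under products. On row vectors the matrix product
    composes in reverse order, which commutativity absorbs. *)
Lemma mulU_mxM X Y : mulU_mx (U Y X) = mulU_mx Y *m mulU_mx X.
Proof.
apply/row_matrixP => i; rewrite !rowE mulmxA !mulU_mxE.
by rewrite (Uc Y) Ua.
Qed.

Lemma mulU_mxP k X Y : mulU_mx (k *: X + Y) = k *: mulU_mx X + mulU_mx Y.
Proof.
apply/row_matrixP => i; rewrite !rowE mulmxDr -scalemxAr !mulU_mxE.
by rewrite Uc Ulin !(Uc (delta_mx _ _)).
Qed.

Lemma mulU_nilpotent : (forall X, \tr (mulU_mx X) = 0) ->
  forall X v, iter n (U X) v = 0.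
Proof.
move=> tr0 X v.
have -> : iter n (U X) v = iter n (mulmx^~ (mulU_mx X)) v.
  by apply: eq_iter => w; rewrite mulU_mxE.
apply: (@traceless_subalgebra_nilpotent _ _ (range mulU_mx)).
- by move=> k _ _ [Y _ <-] [Z _ <-]; exists (k *: Y + Z); rewrite // mulU_mxP.
- by move=> _ _ [Y _ <-] [Z _ <-]; exists (U Y Z); rewrite // mulU_mxM.
- by move=> _ [Y _ <-].
- by exists X.
Qed.

Hypothesis Unil : forall X v, iter n (U X) v = 0.

Lemma is_derive_scale_vector (f : R -> R) (y : R -> V) (t : R) f' y' :
  is_derive t 1 f f' -> is_derive t 1 y y' ->
  is_derive t 1 (fun s => f s *: y s) (f' *: y t + f t *: y').
Proof.
move=> df dy; apply/is_derive_mxP => i j.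
have -> : (fun s => (f s *: y s) i j) = (fun s => f s * y s i j).
  by apply/funext => s; rewrite mxE.
rewrite !mxE; apply: is_derive_mul => //.
exact: ((is_derive_mxP _ _ _ _).1 dy).
Qed.

Lemma is_derive_U (u w : R -> V) (t : R) u' w' :
  is_derive t 1 u u' -> is_derive t 1 w w' ->
  is_derive t 1 (fun s => U (u s) (w s)) (U u' (w t) + U (u t) w').
Proof.
move=> du dw; apply: (@is_derive_apply_linear _ _ _ _ (mulU \o u) (U u')) => // z.
have -> : (fun s => (mulU \o u) s z) = (fun s => mulU z (u s)).
  by apply/funext => s; exact: Uc.
rewrite -(add0r (U _ _)) Uc.
apply: (@is_derive_apply_linear _ _ _ _ (fun=> mulU z) (fun=> 0)) => // y.
exact: is_derive_cst.
Qed.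

(** Injectivity of 1 + t L_X: the difference d satisfies d = - t L_X d, and n iterations of this
    kill it by nilpotency. *)
Lemma resolvent_unique X t z b c : b + t *: U X b = z -> c + t *: U X c = z -> b = c.
Proof.
move=> bE cE; apply/eqP; rewrite -subr_eq0; apply/eqP; set d := b - c.
have dE : d = - t *: mulU X d.
  rewrite /d linearB !mulUE scaleNr; apply/eqP.
  rewrite -addr_eq0 scalerBr addrACA -opprD bE cE subrr; exact: eqxx.
have dk k : d = (- t) ^+ k *: iter k (mulU X) d.
  elim: k => [|k IH]; first by rewrite scale1r.
  have E : mulU X d = (- t) ^+ k *: iter k.+1 (mulU X) d by rewrite {1}IH linearZ.
  by rewrite exprS -scalerA -E.
by rewrite (dk n) (Unil X) scaler0.
Qed.

Lemma is_derive_exp (f : R -> R) f' k (t : R) : is_derive t 1 f f' ->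
  is_derive t 1 (fun s => f s ^+ k) (k%:R * f t ^+ k.-1 * f').
Proof.
move=> df; elim: k => [|k IH].
  by rewrite !mul0r; exact: is_derive_cst.
have -> : (fun s => f s ^+ k.+1) = (fun s => f s * f s ^+ k).
  by apply/funext => s; rewrite exprS.
apply: is_derive_eq (is_derive_mul df IH) _.
case: k {IH} => [|k]; first by rewrite !expr0; ring.
by rewrite /= !exprS -!natr1; ring.
Qed.

(** The power X^(k+1): without a unit the powers start at X, hence the shift of the index. *)
Definition Upow (k : nat) (X : V) : V := iter k (U X) X.

(* In a nilpotent algebra the solution of [x' = - x^2] through [X] at [t0] is
   the polynomial [X (1 + (t - t0) X)^-1], and conversely
   [x (1 - (t - t0) x)^-1] is a first integral. *)
Definition geometric (c : R) (X : V) : V := \sum_(k < n) c ^+ k *: Upow k X.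

Lemma Upow_nil X : Upow n X = 0. Proof. exact: Unil. Qed.

(** Characterizes [geometric c X] as X (1 - c X)^-1. The sum telescopes, and its last term is a
    multiple of X^(n+1) = 0. *)
Lemma geometricE c X : geometric c X - c *: U X (geometric c X) = X.
Proof.
rewrite /geometric -mulUE linear_sum scaler_sumr -sumrB.
rewrite -(big_mkord xpredT
  (fun i => c ^+ i *: Upow i X - c *: mulU X (c ^+ i *: Upow i X))).
rewrite (@telescope_sumr_eq _ 0 n (fun k => - (c ^+ k *: Upow k X)))//.
  by rewrite Upow_nil scaler0 oppr0 sub0r opprK expr0 scale1r.
move=> k _.
have -> : mulU X (c ^+ k *: Upow k X) = c ^+ k *: Upow k.+1 X.
  exact: (linearZ_LR (mulU X)).
by rewrite scalerA -exprS opprK addrC.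
Qed.

(** In powers: (x^(k+1))' = (k+1) x^k x' = - (k+1) x^(k+2), by x' = - x^2. *)
Lemma is_derive_Upow (x : R -> V) k (t : R) :
  is_derive t 1 x (- U (x t) (x t)) ->
  is_derive t 1 (fun s => Upow k (x s)) (- (k.+1%:R *: Upow k.+1 (x t))).
Proof.
move=> dx; elim: k => [|k IH]; first by rewrite scale1r.
apply: is_derive_eq (is_derive_U dx IH) _.
have UN Y Z : U Y (- Z) = - U Y Z by exact: (linearN (mulU Y)).
have -> : U (- U (x t) (x t)) (Upow k (x t)) = - Upow k.+2 (x t).
  by rewrite Uc UN Uc Ua.
have -> : U (x t) (- (k.+1%:R *: Upow k.+1 (x t))) =
    - (k.+1%:R *: Upow k.+2 (x t)).
  by rewrite UN; congr (- _); exact: (linearZ_LR (mulU (x t))).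
by rewrite -opprD -[X in X + _]scale1r -scalerDl -[in RHS]natr1 addrC.
Qed.

Lemma is_derive_geometric (x : R -> V) (t0 t : R) :
  is_derive t 1 x (- U (x t) (x t)) ->
  is_derive t 1 (fun s => geometric (s - t0) (x s)) 0.
Proof.
move=> dx.
have dt : is_derive t 1 (fun s : R => s - t0) 1.
  by apply: (@is_derive_eq _ _ _ (id - cst t0)); rewrite subr0.
(* The factor of (t - t0)^k and the power of x are differentiated in turn; the second contribution
   at k cancels the first at k + 1. The truncated [k.-1] at k = 0 is harmless, being multiplied by
   0. *)
pose d k := (k%:R * (t - t0) ^+ k.-1 * 1) *: Upow k (x t) +
  (t - t0) ^+ k *: - (k.+1%:R *: Upow k.+1 (x t)).
have -> : 0 = \sum_(k < n) d k.
  rewrite -(big_mkord xpredT d).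
  rewrite (@telescope_sumr_eq _ 0 n
    (fun k => - ((k%:R * (t - t0) ^+ k.-1) *: Upow k (x t))))//.
    by rewrite Upow_nil scaler0 mul0r scale0r !oppr0 addr0.
  by move=> k _; rewrite /d mulr1 opprK addrC scalerN scalerA (mulrC _ k.+1%:R).
apply: is_derive_bigsum => k; apply: is_derive_scale_vector; last exact: is_derive_Upow.
exact: is_derive_exp.
Qed.

Lemma quadratic_ode_polynomial (I : set R) (x : R -> V) (t0 : R) :
  is_interval I -> I t0 ->
  (forall t : R, I t -> is_derive t 1 x (- U (x t) (x t))) ->
  exists P : R -> V, (forall t : R, is_derive t 1 P (- U (P t) (P t))) /\
    (forall t, I t -> P t = x t).
Proof.
move=> iI It0 dx; set X := x t0.
(* The sign is reversed, since X (1 + (t - t0) X)^-1 is wanted. *)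
pose P t := geometric (t0 - t) X.
have PE t : P t + (t - t0) *: U X (P t) = X.
  by have := geometricE (t0 - t) X; rewrite -scaleNr opprB.
have dt (t : R) : is_derive t 1 (fun s : R => s - t0) 1.
  by apply: (@is_derive_eq _ _ _ (id - cst t0)); rewrite subr0.
have dt' (t : R) : is_derive t 1 (fun s : R => t0 - s) (-1).
  by apply: (@is_derive_eq _ _ _ (cst t0 - id)); rewrite sub0r.
exists P; split=> t.
  have dP : is_derive t 1 P ('D_1 P t).
    have [dP _] : is_derive t 1 P (\sum_(k < n)
        ((k%:R * (t0 - t) ^+ k.-1 * -1) *: Upow k X + (t0 - t) ^+ k *: 0)).
      apply: is_derive_bigsum => k; apply: is_derive_scale_vector.
      exact: is_derive_exp.
    exact: derivableP.
  (* Instead of computing Q from the sum, the identity [PE] is differentiated: Q + (t - t0) U(X, Q)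
     = - U(X, P). Since - U(P, P) solves the same linear equation, it equals Q. *)
  set Q := 'D_1 P t in dP *.
  have dPE : is_derive t 1 (fun s => P s + (s - t0) *: U X (P s)) 0.
    have -> : (fun s => P s + (s - t0) *: U X (P s)) = cst X by exact/funext.
    exact: is_derive_cst.
  have dUP := is_derive_U (is_derive_cst X t 1) dP.
  have E := is_derive_unique (is_deriveD dP (is_derive_scale_vector (dt t) dUP)) dPE.
  have U0 Y : U 0 Y = 0 by rewrite Uc; exact: (linear0 (mulU Y)).
  have UN Y Z : U Y (- Z) = - U Y Z by exact: (linearN (mulU Y)).
  have UP Y : U Y (P t) + (t - t0) *: U Y (U X (P t)) = U Y X.
    by rewrite -[in RHS](PE t) addrC -Ulin addrC.
  have QE : Q + (t - t0) *: U X Q = - U X (P t).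
    apply/eqP; rewrite -addr_eq0 -[X in _ == X]E; apply/eqP.
    by rewrite scale1r U0 add0r addrAC -addrA.
  suff -> : - U (P t) (P t) = Q by [].
  apply: resolvent_unique QE.
  rewrite UN scalerN -opprD; congr (- _).
  by rewrite -Ua (Uc _ (P t)) UP Uc.
(* If the first integral still has the value X at t, then [geometricE] says that x(t) solves the
   linear equation [PE] of P(t). *)
have It_const : I t -> geometric (t - t0) (x t) = X -> P t = x t.
  move=> It yE; apply: (@resolvent_unique X (t - t0) X); first exact: PE.
  have := geometricE (t - t0) (x t); rewrite yE (Uc (x t)) => /eqP.
  by rewrite subr_eq => /eqP <-.
move=> It; apply: It_const => //.
have dy (s : R) : I s -> is_derive s 1 (fun s => geometric (s - t0) (x s)) 0.
  by move=> Is; apply: is_derive_geometric; exact: dx.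
rewrite (is_derive0_constant iI dy It It0) subrr.
by have := geometricE 0 (x t0); rewrite scale0r subr0.
Qed.

End CommutativeAssociative.

(** * Traces of the multiplication operators under class W_0 *)

Section UtensorAlgebra.
Variables (R : realType) (n : nat).
Notation V := 'rV[R]_n.
Variables (br : V -> V -> V) (form : {biscalar V}) (U : V -> V -> V).
Hypothesis brC : forall X Y, br X Y = - br Y X.
Hypothesis br_linear : forall X, linear (br X).
Hypothesis form_sym : form_symmetric form.
Hypothesis form_nondeg : form_nondegenerate form.
Hypothesis UP : is_Utensor br form U.

Let two_neq0 : (2 : R) != 0. Proof. by rewrite pnatr_eq0. Qed.

Lemma form_inj X Y : (forall Z, form X Z = form Y Z) -> X = Y.
Proof.
move=> XY; apply/eqP; rewrite -subr_eq0; apply/eqP/form_nondeg => Z.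
by rewrite linearBl XY subrr.
Qed.

Lemma UtensorC X Y : U X Y = U Y X.
Proof. by apply: form_inj => Z; apply: (mulfI two_neq0); rewrite !UP addrC. Qed.

Lemma Utensor_linear X : linear (U X).
Proof.
move=> k Y Y'; apply: form_inj => Z; apply: (mulfI two_neq0).
rewrite UP linearPl /= mulrDr mulrCA !UP br_linear linearPl linearPr /=; ring.
Qed.

Let g := gram form 1%:M.

Lemma gram1E i j : g i j = form (delta_mx 0 i) (delta_mx 0 j).
Proof. by rewrite mxE !row1. Qed.

Lemma gram1_sym : g^T = g.
Proof. by apply/matrixP => i j; rewrite mxE !gram1E form_sym. Qed.

Lemma row_mul_gram1 (v : V) j : (v *m g) 0 j = form v (delta_mx 0 j).
Proof.
rewrite mxE [in RHS](row_sum_delta v) linear_sumlz; apply: eq_bigr => i _.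
by rewrite linearZl_LR gram1E.
Qed.

Lemma gram1_unit : g \in unitmx.
Proof.
rewrite -row_free_unit; apply/inj_row_free => v vg0; apply: form_nondeg => Y.
rewrite (row_sum_delta Y) linear_sumr big1// => j _.
by rewrite linearZr_LR /= -row_mul_gram1 vg0 mxE mulr0.
Qed.

Let ginv_sym i j : invmx g i j = invmx g j i.
Proof. by rewrite -[in LHS]gram1_sym -trmx_inv mxE. Qed.

Lemma sum_antisym (h : 'I_n -> 'I_n -> R) :
  (forall i j, h i j = - h j i) -> \sum_i \sum_j invmx g i j * h i j = 0.
Proof.
move=> hC; set s := \sum_i _; suff : s = - s.
  by move/eqP; rewrite -addr_eq0 -mulr2n mulrn_eq0 => /eqP.
rewrite {1}/s exchange_big -sumrN; apply: eq_bigr => i _.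
by rewrite -sumrN; apply: eq_bigr => j _; rewrite ginv_sym hC mulrN.
Qed.

(** 2 tr L_X is the contraction of <[e_k, X], e_i> + <[e_k, e_i], X> with the inverse Gram matrix.
    The second term is antisymmetric in i, k and contributes 0; the first gives - tr (ad X), which
    class W_0 annihilates. The map [f] carries U with its linearity. *)
Lemma W0_trace (f : V -> {linear V -> V}) X :
  (forall Y, f X Y = U X Y) -> class_W0 form U -> \tr (lin1_mx (f X)) = 0.
Proof.
move=> fE W0; set A := lin1_mx (f X); pose e i : V := delta_mx 0 i.
have Ae i k : (A *m g) i k = form (U X (e i)) (e k).
  have -> : (A *m g) i k = (row i (A *m g)) 0 k by rewrite [RHS]mxE.
  by rewrite row_mul row_mul_gram1 rowE mul_rV_lin1 fE.
have -> : \tr A = \sum_i \sum_k invmx g k i * form (U X (e i)) (e k).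
  rewrite -{1}(mulmx1 A) -(mulmxV gram1_unit) mulmxA /mxtrace.
  by apply: eq_bigr => i _; rewrite mxE; apply: eq_bigr => k _; rewrite Ae mulrC.
pose h i k := form (br X (e i)) (e k).
(* This sum is tr (ad X). The two halves of 2 theta(e_i, e_k, X) contract to the same number, so
   class W_0 in the standard basis makes it 0. *)
have W : \sum_i \sum_k invmx g i k * h i k = 0.
  have := W0 1%:M (unitmx1 _ _) X; rewrite -/g => W1.
  apply: (mulfI two_neq0); rewrite mulr0 -[RHS](mulr0 2) -[in RHS]W1.
  have -> : 2 * (\sum_i \sum_k invmx g i k * h i k) =
      \sum_i \sum_k invmx g i k * h i k + \sum_i \sum_k invmx g i k * h k i.
    rewrite mulr_natl mulr2n; congr (_ + _); rewrite exchange_big.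
    by apply: eq_bigr => i _; apply: eq_bigr => j _; rewrite ginv_sym.
  rewrite -big_split mulr_sumr; apply: eq_bigr => i _.
  rewrite -big_split mulr_sumr; apply: eq_bigr => j _.
  by rewrite /= -mulrDr !row1 mulrCA /theta UP.
have H1 : \sum_i \sum_k invmx g k i * h k i = 0 by rewrite exchange_big.
have H2 : \sum_i \sum_k invmx g k i * form (br (e k) (e i)) X = 0.
  rewrite exchange_big; apply: (@sum_antisym (fun k i => form (br (e k) (e i)) X)).
  by move=> k i; rewrite brC linearNl.
apply: (mulfI two_neq0); rewrite mulr0 -[RHS]subr0 -[X in _ = _ - X]H1 -[X in _ = X - _]H2.
rewrite -sumrB mulr_sumr; apply: eq_bigr => i _.
rewrite -sumrB mulr_sumr; apply: eq_bigr => k _.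
rewrite mulrCA UP (brC (e k) X) linearNl -/(h k i); ring.
Qed.

End UtensorAlgebra.

(** * Lie groups in coordinates *)

Lemma within_open_continuous (S T : topologicalType) (A : set S) (f : S -> T) x :
  open A -> {within A, continuous f} -> A x -> {for x, continuous f}.
Proof.
by move=> oA; rewrite continuous_open_subspace// => cf Ax; apply: cf; rewrite inE.
Qed.

Section Charts.
Variables (R : realType) (n : nat) (M : topologicalType) (a : chart R n M).

Lemma chartK p : chart_dom a p -> chart_inv a (a p) = p.
Proof. by move=> ap; apply: chart_funK; rewrite inE. Qed.

Lemma chart_img_inv x : chart_img a x ->
  chart_dom a (chart_inv a x) /\ a (chart_inv a x) = x.
Proof. by move=> [p ap <-]; rewrite chartK. Qed.

Lemma chart_inv_continuous x : chart_img a x -> {for x, continuous (chart_inv a)}.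
Proof. exact: within_open_continuous (@chart_img_open _ _ _ a) (@chart_inv_cont _ _ _ a). Qed.

Lemma near_chart_dom p : chart_dom a p -> \forall q \near p, chart_dom a q.
Proof. by move=> ap; exact: open_nbhs_nbhs (conj (@chart_dom_open _ _ _ a) ap). Qed.

Lemma near_chart_img x : chart_img a x -> \forall y \near x, chart_img a y.
Proof. by move=> ax; exact: open_nbhs_nbhs (conj (@chart_img_open _ _ _ a) ax). Qed.

End Charts.

Section LieGroupCoordinates.
Variables (R : realType) (n : nat) (G : lieGroup R n).
Notation V := 'rV[R]_n.
Implicit Types (a b c d : chart R n G) (p q g h : G).

Lemma atlas_chart1 : atlas (chart1 G). Proof. exact: chart_at_atlas. Qed.

Lemma chart1_dom : chart_dom (chart1 G) 1%g. Proof. exact: chart_at_dom. Qed.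

Lemma left_translation_continuous g : continuous (left_translation g : G -> G).
Proof.
move=> h; apply: (@continuous_comp _ _ _ (fun h => (g, h)) (fun p : G * G => (p.1 * p.2)%g)).
  by apply: cvg_pair => /=; [exact: cvg_cst|exact: cvg_id].
exact: lie_mul_cont.
Qed.

Definition mulc a b c (z : V * V) : V := c (chart_inv a z.1 * chart_inv b z.2)%g.

Definition mulc_dom a b c : set (V * V) :=
  [set z | [/\ chart_img a z.1, chart_img b z.2 &
     chart_dom c (chart_inv a z.1 * chart_inv b z.2)%g]].

Lemma mulc_smooth a b c : atlas a -> atlas b -> atlas c ->
  smooth_on (mulc_dom a b c) (mulc a b c).
Proof. exact: lie_mul_smooth. Qed.

(** Openness is what [smooth_on_schwarz] asks of the domain on which multiplication is smooth. *)
Lemma mulc_dom_open a b c : open (mulc_dom a b c).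
Proof.
rewrite openE => -[x y] [/= ax by_ cxy].
have cmul : {for (x, y), continuous
    (fun z : V * V => chart_inv a z.1 * chart_inv b z.2)%g}.
  apply: (@continuous2_cvg _ _ _ _ _ _ (chart_inv a \o fst) (chart_inv b \o snd)
    (fun g h : G => (g * h)%g) (chart_inv a x) (chart_inv b y)).
  - exact (@lie_mul_cont _ _ G (chart_inv a x, chart_inv b y)).
  - have ca : {for x, continuous (chart_inv a)} by exact: chart_inv_continuous.
    have cf : {for (x, y), continuous (@fst V V)} by exact: cvg_fst.
    exact (@continuous_comp _ _ _ (@fst V V) (chart_inv a) (x, y) cf ca).
  - have cb : {for y, continuous (chart_inv b)} by exact: chart_inv_continuous.
    have cs : {for (x, y), continuous (@snd V V)} by exact: cvg_snd.
    exact (@continuous_comp _ _ _ (@snd V V) (chart_inv b) (x, y) cs cb).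
have n1 : \forall z \near (x, y), chart_img a z.1.
  by apply: cvg_fst; exact: near_chart_img.
have n2 : \forall z \near (x, y), chart_img b z.2.
  by apply: cvg_snd; exact: near_chart_img.
have n3 : \forall z \near (x, y), chart_dom c (chart_inv a z.1 * chart_inv b z.2)%g.
  by apply: cmul; exact: near_chart_dom.
by apply: filterS (filterI (filterI n1 n2) n3) => z [[]].
Qed.

Lemma mulc_dom_point a b c g p : chart_dom a g -> chart_dom b p ->
  chart_dom c (g * p)%g -> mulc_dom a b c (a g, b p).
Proof.
move=> ag bp cgp; split => /=; [by exists g|by exists p|].
by rewrite !chartK.
Qed.

Lemma derive_snd (W : normedModType R) (F : V * V -> W) x y v :
  differentiable F (x, y) ->
  differentiable (fun z => F (x, z)) y /\
  'D_v (fun z => F (x, z)) y = 'D_(0, v) F (x, y).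
Proof.
move=> dF.
have dp : is_diff y (fun z : V => (x, z)) (fun w : V => (0, w)).
  exact: (is_diff_pair (is_diff_cst x y) (is_diff_id y)).
have [dp1 dpE] := dp.
have E : 'D_v (fun z : V => (x, z)) y = (0, v) by rewrite deriveE// dpE.
split; first exact: (@differentiable_comp _ _ _ _ (fun z : V => (x, z)) F).
by rewrite -E; exact: (@derive_comp _ _ _ _ F (fun z : V => (x, z))).
Qed.

Lemma derive_fst (W : normedModType R) (F : V * V -> W) x y v :
  differentiable F (x, y) ->
  differentiable (fun z => F (z, y)) x /\
  'D_v (fun z => F (z, y)) x = 'D_(v, 0) F (x, y).
Proof.
move=> dF.
have dp : is_diff x (fun z : V => (z, y)) (fun w : V => (w, 0)).
  exact: (is_diff_pair (is_diff_id x) (is_diff_cst y x)).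
have [dp1 dpE] := dp.
have E : 'D_v (fun z : V => (z, y)) x = (v, 0) by rewrite deriveE// dpE.
split; first exact: (@differentiable_comp _ _ _ _ (fun z : V => (z, y)) F).
by rewrite -E; exact: (@derive_comp _ _ _ _ F (fun z : V => (z, y))).
Qed.

Section Tangent.
Variables (a b c : chart R n G).
Hypotheses (Aa : atlas a) (Ab : atlas b) (Ac : atlas c).

Lemma translation_mulc g : chart_dom a g ->
  c \o left_translation g \o chart_inv b = fun y => mulc a b c (a g, y).
Proof. by move=> ag; apply/funext => y; rewrite /mulc/= chartK. Qed.

(** A left translation is multiplication with its first coordinate frozen. Its tangent map is thus a
    partial derivative of one jointly smooth function, which gives regularity in [g] as well. *)
Lemma tangent_mapE g p v : chart_dom a g -> chart_dom b p ->
  chart_dom c (g * p)%g ->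
  tangent_map b c (left_translation g) p v = 'D_(0, v) (mulc a b c) (a g, b p).
Proof.
move=> ag bp cgp.
have dm : differentiable (mulc a b c) (a g, b p).
  exact: smooth_on_differentiable (mulc_smooth Aa Ab Ac) (mulc_dom_point ag bp cgp).
rewrite /tangent_map (translation_mulc ag).
by have [dm2 <-] := derive_snd v dm; rewrite deriveE.
Qed.

End Tangent.

Lemma translation_differentiable b c g p : atlas b -> atlas c ->
  chart_dom b p -> chart_dom c (g * p)%g ->
  differentiable (c \o left_translation g \o chart_inv b) (b p).
Proof.
move=> Ab Ac bp cgp; have ag := chart_at_dom g.
rewrite (translation_mulc _ _ ag).
apply: (derive_snd 0 _).1.
exact: smooth_on_differentiable (mulc_smooth (chart_at_atlas g) Ab Ac)
  (mulc_dom_point ag bp cgp).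
Qed.

Lemma near_translation b c g p : chart_dom b p -> chart_dom c (g * p)%g ->
  \forall y \near b p, chart_img b y /\ chart_dom c (g * chart_inv b y)%g.
Proof.
move=> bp cgp; have bbp : chart_img b (b p) by exists p.
apply: filterI; first exact: near_chart_img.
have cinv := chart_inv_continuous bbp.
have : {for b p, continuous (left_translation g \o chart_inv b)}.
  by apply: continuous_comp => //; exact: left_translation_continuous.
by apply; apply: near_chart_dom; rewrite /= chartK.
Qed.

Lemma tangent_map_derive b c g p v : atlas b -> atlas c ->
  chart_dom b p -> chart_dom c (g * p)%g ->
  tangent_map b c (left_translation g) p v =
  'D_v (c \o left_translation g \o chart_inv b) (b p).
Proof.
by move=> Ab Ac bp cgp; rewrite (deriveE v (translation_differentiable Ab Ac bp cgp)).
Qed.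

Lemma tangent_map_comp b c d g h p v : atlas b -> atlas c -> atlas d ->
  chart_dom b p -> chart_dom c (h * p)%g -> chart_dom d (g * (h * p))%g ->
  tangent_map b d (left_translation (g * h)%g) p v =
  tangent_map c d (left_translation g) (h * p)%g
    (tangent_map b c (left_translation h) p v).
Proof.
move=> Ab Ac Ad bp chp dghp.
have dghp' : chart_dom d (g * h * p)%g by rewrite -mulgA.
have d1 := translation_differentiable Ab Ac bp chp.
have d2 := translation_differentiable Ac Ad chp dghp.
have bE : c (h * p)%g = (c \o left_translation h \o chart_inv b) (b p).
  by rewrite /= chartK.
rewrite !tangent_map_derive//; rewrite bE in d2 *.
rewrite -(derive_comp v d1 d2); apply: near_eq_derive.
apply: filterS (near_translation bp chp) => y [_ chy] /=.
by rewrite chartK// /left_translation mulgA.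
Qed.

Lemma tangent_map1 b p v : atlas b -> chart_dom b p ->
  tangent_map b b (left_translation (1%g : G)) p v = v.
Proof.
move=> Ab bp; have bbp : chart_img b (b p) by exists p.
rewrite tangent_map_derive ?mul1g//.
rewrite -[RHS](derive_id (b p)); apply: near_eq_derive.
apply: filterS (near_chart_img bbp) => y /chart_img_inv[_ by_].
by rewrite /= /left_translation mul1g.
Qed.

(* [lfield a x X] and [mcform a x v] are the values at the point with a-coordinates
   [x] of the left-invariant field of [X] and of the Maurer-Cartan form. *)
Definition lfield a x X : V := left_invariant_field a X x.

Definition mcform a (x : V) : {linear V -> V} :=
  'd (chart1 G \o left_translation (chart_inv a x)^-1%g \o chart_inv a)
    (a (chart_inv a x)).

Lemma mcformE a x v : mcform a x v =
  tangent_map a (chart1 G) (left_translation (chart_inv a x)^-1%g) (chart_inv a x) v.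
Proof. by []. Qed.

Notation e := (chart1 G 1%g).

Lemma translation_lfield a c g p X : atlas a -> atlas c -> chart_dom a p ->
  chart_dom c (g * p)%g ->
  tangent_map a c (left_translation g) p (lfield a (a p) X) = lfield c (c (g * p)%g) X.
Proof.
move=> Aa Ac ap cgp; rewrite /lfield /left_invariant_field !chartK//.
have A1 := atlas_chart1; have d1 := chart1_dom.
by rewrite (@tangent_map_comp (chart1 G) a c) ?mulg1.
Qed.

Lemma lfield_chart1 X : lfield (chart1 G) e X = X.
Proof.
have A1 := atlas_chart1; have d1 := chart1_dom.
by rewrite /lfield /left_invariant_field chartK// tangent_map1.
Qed.

Lemma mcform_lfield a x X : atlas a -> chart_img a x -> mcform a x (lfield a x X) = X.
Proof.
move=> Aa /chart_img_inv[ap apx]; rewrite -[in lfield _ _]apx mcformE.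
have A1 := atlas_chart1; have d1 := chart1_dom.
by rewrite translation_lfield ?mulVg// lfield_chart1.
Qed.

Lemma lfield_mcform a x v : atlas a -> chart_img a x -> lfield a x (mcform a x v) = v.
Proof.
move=> Aa /chart_img_inv[ap apx]; rewrite /lfield /left_invariant_field mcformE.
have A1 := atlas_chart1; have d1 := chart1_dom.
set p := chart_inv a x.
apply: etrans (tangent_map1 v Aa ap).
have -> : left_translation (1%g : G) = left_translation (p * p^-1)%g by rewrite mulgV.
by rewrite (@tangent_map_comp a (chart1 G) a p p^-1%g p v) ?mulVg ?mulg1.
Qed.

Lemma lfield_linear a x : linear (lfield a x).
Proof. by move=> k u v; rewrite /lfield /left_invariant_field /tangent_map linearP. Qed.

Lemma curve_translation (gamma : R -> G) b c g s v : atlas b -> atlas c ->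
  {for s, continuous gamma} ->
  chart_dom b (gamma s) -> chart_dom c (g * gamma s)%g ->
  is_derive s 1 (b \o gamma) v ->
  is_derive s 1 (fun t => c (g * gamma t)%g)
    (tangent_map b c (left_translation g) (gamma s) v).
Proof.
move=> Ab Ac cg bs cgs db; rewrite tangent_map_derive//.
have df := translation_differentiable Ab Ac bs cgs.
apply: near_eq_is_derive (is_derive_comp db df).
have nb : \forall t \near s, chart_dom b (gamma t).
  by apply: cg; exact: near_chart_dom.
by apply: filterS nb => t bt; rewrite /= chartK.
Qed.

(* The velocity of [gamma] at [s], left-translated to the identity, is [X]. *)
Definition velocity (gamma : R -> G) (s : R) (X : V) :=
  {for s, continuous gamma} /\
  is_derive s 1 (fun t => chart1 G ((gamma s)^-1 * gamma t)%g) X.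

(** Each direction translates the curve: by the inverse of [gamma s] to reach the identity, and by
    [gamma s] to come back. *)
Lemma velocityP (gamma : R -> G) a s X : atlas a -> chart_dom a (gamma s) ->
  {for s, continuous gamma} ->
  velocity gamma s X <-> is_derive s 1 (a \o gamma) (lfield a (a (gamma s)) X).
Proof.
have A1 := atlas_chart1; have d1 := chart1_dom => Aa as_ cg.
split=> [[_ dX]|dL]; last first.
  split => //.
  have -> : X = mcform a (a (gamma s)) (lfield a (a (gamma s)) X).
    by rewrite mcform_lfield//; exists (gamma s).
  rewrite mcformE chartK//.
  by apply: curve_translation; rewrite ?mulVg.
pose delta t := ((gamma s)^-1 * gamma t)%g.
have ds : delta s = 1%g by rewrite /delta mulVg.
have cd : {for s, continuous delta}.
  apply: (@continuous_comp _ _ _ gamma (left_translation (gamma s)^-1%g)) => //.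
  exact: left_translation_continuous.
have := @curve_translation delta (chart1 G) a (gamma s) s X A1 Aa cd.
rewrite ds mulg1 => /(_ d1 as_ dX).
rewrite /lfield /left_invariant_field chartK//.
have -> // : (fun t => a (gamma s * delta t)%g) = a \o gamma.
by apply/funext => t; rewrite /delta mulVKg.
Qed.

End LieGroupCoordinates.

(** * Continuity and differentiability depend only on germs *)

Section NearEq.
Variables (R : realType) (V W : normedModType R).

Lemma near_eq_continuous (f g : V -> W) x : (\forall y \near x, f y = g y) ->
  {for x, continuous f} -> {for x, continuous g}.
Proof.
move=> fg cf; have fgx : f x = g x by exact: nbhs_singleton fg.
apply/cvgrPdist_lt => eps eps0; move/cvgrPdist_lt : cf => /(_ _ eps0) cf.
apply: filterS (filterI fg cf) => y [fgy]; by rewrite fgx fgy.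
Qed.

Lemma near_eq_differentiable (f g : V -> W) x : (\forall y \near x, f y = g y) ->
  differentiable f x -> differentiable g x.
Proof.
move=> fg df; have fgx : f x = g x by exact: nbhs_singleton fg.
have E : g \o shift x = cst (g x) + 'd f x +o_ (0 : V) id.
  apply/eqaddoP => eps eps0.
  have /eqaddoP/(_ _ eps0) := diff_locally df.
  have fg0 : \forall h \near (0 : V), f (h + x) = g (h + x).
    move: fg; rewrite (near_shift 0 x) => fg.
    by apply: filterS fg => h /=; rewrite subr0.
  by apply: filterS2 fg0 => h /= E; rewrite -fgx !fctE/= E.
have dfc : continuous ('d f x) by exact: diff_continuous.
apply/diff_locallyP; rewrite (diff_unique dfc E).
by split.
Qed.

End NearEq.

(** * Left-invariant fields and the Maurer-Cartan equation *)

Section MaurerCartan.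
Variables (R : realType) (n : nat) (G : lieGroup R n).
Notation V := 'rV[R]_n.
Notation e := (chart1 G 1%g).
Implicit Types (a b c : chart R n G).

Lemma differentiable_partial1 (F : V * V -> V) x y :
  differentiable F (x, y) -> differentiable (fun z => F (z, y)) x.
Proof. by move=> dF; exact: (derive_fst 0 dF).1. Qed.

Lemma differentiable_partial2 (F : V * V -> V) x y :
  differentiable F (x, y) -> differentiable (fun z => F (x, z)) y.
Proof. by move=> dF; exact: (derive_snd 0 dF).1. Qed.

(** Multiplication with second factor near 1: its derivatives in that factor at [e] are the
    left-invariant fields, whose regularity is thereby inherited from the group law. *)
Let Fa a := mulc a (chart1 G) a.

Let Fa_dom a x : chart_img a x -> mulc_dom a (chart1 G) a (x, e).
Proof.
move=> [p ap <-]; apply: mulc_dom_point => //; last by rewrite mulg1.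
exact: chart1_dom.
Qed.

Let Fa_smooth a : atlas a -> smooth_on (mulc_dom a (chart1 G) a) (Fa a).
Proof. by move=> Aa; apply: mulc_smooth => //; exact: atlas_chart1. Qed.

Lemma lfield_mulc a x X : atlas a -> chart_img a x ->
  lfield a x X = 'D_(0, X) (Fa a) (x, e).
Proof.
move=> Aa /chart_img_inv[ap apx]; rewrite -[in RHS]apx.
have A1 := atlas_chart1 G; have d1 := chart1_dom G.
by rewrite /lfield /left_invariant_field (tangent_mapE Aa A1 Aa)// mulg1.
Qed.

Let near_lfield_mulc a x X : atlas a -> chart_img a x ->
  \forall y \near x, 'D_(0, X) (Fa a) (y, e) = lfield a y X.
Proof.
by move=> Aa ax; apply: filterS (near_chart_img ax) => y ay; rewrite lfield_mulc.
Qed.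

Lemma lfield_differentiable a x X : atlas a -> chart_img a x ->
  differentiable (fun y => lfield a y X) x.
Proof.
move=> Aa ax; apply: near_eq_differentiable (near_lfield_mulc X Aa ax) _.
apply: (@differentiable_partial1 ('D_(0, X) (Fa a))).
exact: smooth_on_differentiable (smooth_on_derive _ (Fa_smooth Aa))
  (Fa_dom ax).
Qed.

Let derive_lfield_mulc a x u X : atlas a -> chart_img a x ->
  'D_u (fun y => lfield a y X) x = 'D_(u, 0) ('D_(0, X) (Fa a)) (x, e).
Proof.
move=> Aa ax; rewrite -(near_eq_derive _ (near_lfield_mulc X Aa ax)).
have dF := smooth_on_differentiable (smooth_on_derive (0, X) (Fa_smooth Aa)) (Fa_dom ax).
exact: (derive_fst u dF).2.
Qed.

Lemma derive_lfield_continuous a x u X : atlas a -> chart_img a x ->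
  {for x, continuous ('D_u (fun y => lfield a y X))}.
Proof.
move=> Aa ax.
apply: (@near_eq_continuous _ _ _ (fun y => 'D_(u, 0) ('D_(0, X) (Fa a)) (y, e))).
  by apply: filterS (near_chart_img ax) => y ay; rewrite derive_lfield_mulc.
apply: differentiable_continuous.
apply: (@differentiable_partial1 ('D_(u, 0) ('D_(0, X) (Fa a)))).
exact: smooth_on_differentiable
  (smooth_on_derive _ (smooth_on_derive _ (Fa_smooth Aa))) (Fa_dom ax).
Qed.

(** The base point p enters twice, as p and as p^-1. The form is therefore a derivative of
    multiplication composed with y -> ([iota y], y), and smoothness of inversion comes in. *)
Lemma mcform_differentiable a x v : atlas a -> chart_img a x ->
  differentiable (fun y => mcform a y v) x.
Proof.
move=> Aa ax; have [ap apx] := chart_img_inv ax.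
have A1 := atlas_chart1 G; have d1 := chart1_dom G.
pose b := chart_at ((chart_inv a x)^-1%g : G).
have Ab : atlas b by exact: chart_at_atlas.
have bp : chart_dom b (chart_inv a x)^-1%g by exact: chart_at_dom.
pose iota y := b (chart_inv a y)^-1%g.
have diota : differentiable iota x.
  exact: smooth_on_differentiable (lie_inv_smooth Aa Ab) (conj ax bp).
have nb : \forall y \near x, chart_dom b (chart_inv a y)^-1%g.
  have cinv : {for chart_inv a x, continuous (fun g : G => g^-1%g)}.
    exact (@lie_inv_cont _ _ G (chart_inv a x)).
  have ca := chart_inv_continuous ax.
  have : {for x, continuous ((fun g : G => g^-1%g) \o chart_inv a)}.
    exact: continuous_comp.
  by apply; exact: near_chart_dom.
apply: (@near_eq_differentiable _ _ _
    (fun y => 'D_(0, v) (mulc b a (chart1 G)) (iota y, y))).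
  apply: filterS (filterI (near_chart_img ax) nb) => y [ay by_].
  have [ay1 ay2] := chart_img_inv ay.
  rewrite mcformE (tangent_mapE Ab Aa A1) ?mulVg// ay2//.
apply: (@differentiable_comp _ _ _ _ (fun y => (iota y, y))
  ('D_(0, v) (mulc b a (chart1 G)))).
  by apply: differentiable_pair.
apply: smooth_on_differentiable (smooth_on_derive _ (mulc_smooth Ab Aa A1)) _.
rewrite -[in X in (_, X)]apx.
by apply: mulc_dom_point => //; rewrite mulVg.
Qed.

(* Left translation by the point with coordinates [x] relates the
   left-invariant fields in the charts [chart1] and [a]; the second-order terms
   of this coordinate change cancel by symmetry of second derivatives. *)
Lemma lfield_bracket a x X Y : atlas a -> chart_img a x ->
  'D_(lfield a x X) (fun y => lfield a y Y) x - 'D_(lfield a x Y) (fun y => lfield a y X) x =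
  lfield a x (lie_bracket G X Y).
Proof.
move=> Aa ax; have [ap apx] := chart_img_inv ax.
have A1 := atlas_chart1 G; have d1 := chart1_dom G.
have i1 : chart_img (chart1 G) e by exists 1%g.
pose phi z := Fa a (x, z).
have phiE : phi = a \o left_translation (chart_inv a x) \o chart_inv (chart1 G).
  by apply/funext.
have phie : phi e = x by rewrite phiE/= chartK// /left_translation mulg1.
have nphi : \forall z \near e, chart_img (chart1 G) z /\
    mulc_dom a (chart1 G) a (x, z).
  have ap1 : chart_dom a (chart_inv a x * 1)%g by rewrite mulg1.
  by apply: filterS (near_translation d1 ap1) => z [].
have dphi z : mulc_dom a (chart1 G) a (x, z) -> differentiable phi z.
  move=> az; apply: (@differentiable_partial2 (Fa a)).
  exact: smooth_on_differentiable (Fa_smooth Aa) az.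
have dphiE z w : mulc_dom a (chart1 G) a (x, z) ->
    'd phi z w = 'D_(0, w) (Fa a) (x, z).
  move=> az; rewrite -deriveE; last exact: dphi.
  have dF := smooth_on_differentiable (Fa_smooth Aa) az.
  exact: (derive_snd w dF).2.
have LphiE Z : \forall z \near e, 'd phi z (lfield (chart1 G) z Z) = lfield a (phi z) Z.
  apply: filterS nphi => z [z1 [_ _ /= az]].
  have [zp zpz] := chart_img_inv z1.
  have := translation_lfield Z A1 Aa zp az.
  rewrite /tangent_map -phiE zpz => ->; congr (lfield a _ Z).
(* The product rule splits off the second derivative of multiplication, the only term that is
   symmetric in [Z] and [W]; [key] reads the left side by the chain rule through [LphiE]. *)
have d1E Z W : 'D_Z (fun z => 'd phi z (lfield (chart1 G) z W)) e =
    'D_(0, Z) ('D_(0, W) (Fa a)) (x, e) +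
    lfield a x ('D_Z (fun z => lfield (chart1 G) z W) e).
  have dA w : is_derive e Z (fun z => 'd phi z w)
      ('D_(0, Z) ('D_(0, w) (Fa a)) (x, e)).
    have dF := smooth_on_differentiable (smooth_on_derive (0, w) (Fa_smooth Aa)) (Fa_dom ax).
    have [dF2 <-] := derive_snd Z dF.
    have dder : derivable (fun z => 'D_(0, w) (Fa a) (x, z)) e Z.
      exact: diff_derivable.
    apply: near_eq_is_derive (derivableP dder).
    by apply: filterS nphi => z [_ az]; rewrite dphiE.
  have dL : is_derive e Z (fun z => lfield (chart1 G) z W)
      ('D_Z (fun z => lfield (chart1 G) z W) e).
    by apply: derivableP; apply: diff_derivable; exact: lfield_differentiable.
  have [_ ->] := is_derive_apply_linear dA dL.
  by rewrite lfield_chart1 dphiE ?lfield_mulc//; exact: Fa_dom.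
clearbody phi.
have key Z W : 'D_(lfield a x Z) (fun y => lfield a y W) x =
    'D_(0, Z) ('D_(0, W) (Fa a)) (x, e) +
    lfield a x ('D_Z (fun z => lfield (chart1 G) z W) e).
  rewrite -d1E (near_eq_derive _ (LphiE W)).
  have dL : differentiable (fun y => lfield a y W) (phi e).
    by rewrite phie; exact: lfield_differentiable.
  have de := dphi e (Fa_dom ax).
  have phiZ : 'D_Z phi e = lfield a x Z.
    by rewrite (deriveE Z de) dphiE ?lfield_mulc//; exact: Fa_dom.
  have E := derive_comp (f := fun y => lfield a y W) Z de dL.
  exact: esym (etrans E (congr2 (fun z y => 'D_z (fun y => lfield a y W) y) phiZ phie)).
have SE := smooth_on_schwarz (0, X) (0, Y) (@mulc_dom_open _ _ _ a (chart1 G) a)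
  (Fa_smooth Aa) (Fa_dom ax).
have cancel (s l1 l2 : V) : (s + l1) - (s + l2) = l1 - l2.
  by rewrite opprD addrACA subrr add0r.
apply: etrans (congr2 (fun p q : V => p - q) (etrans (key X Y)
  (congr1 (fun s => s + _) (esym SE))) (key Y X)) _.
rewrite cancel /lie_bracket /field_bracket.
have -> : left_invariant_field (chart1 G) X e = X by exact: lfield_chart1.
have -> : left_invariant_field (chart1 G) Y e = Y by exact: lfield_chart1.
have LB (u v : V) : lfield a x u - lfield a x v = lfield a x (u - v).
  by rewrite -scaleN1r addrC -lfield_linear scaleN1r addrC.
exact: LB.
Qed.

(** Differentiating the constant [mcform a y (lfield a y Y)] moves the derivative from the form to
    the fields; what remains is [lfield_bracket]. *)
Lemma maurer_cartan a x u w : atlas a -> chart_img a x ->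
  'D_u (fun y => mcform a y w) x - 'D_w (fun y => mcform a y u) x =
  - lie_bracket G (mcform a x u) (mcform a x w).
Proof.
move=> Aa ax.
have H v Y : 'D_v (fun y => mcform a y (lfield a x Y)) x =
    - mcform a x ('D_v (fun y => lfield a y Y) x).
  have dA w0 : is_derive x v (fun y => mcform a y w0) ('D_v (fun y => mcform a y w0) x).
    by apply: derivableP; apply: diff_derivable; exact: mcform_differentiable.
  have dL : is_derive x v (fun z => lfield a z Y) ('D_v (fun z => lfield a z Y) x).
    by apply: derivableP; apply: diff_derivable; exact: lfield_differentiable.
  have dE := is_derive_apply_linear dA dL.
  have d0 : is_derive x v (fun y => mcform a y (lfield a y Y)) 0.
    apply: near_eq_is_derive (is_derive_cst Y x v).
    by apply: filterS (near_chart_img ax) => y ay; rewrite mcform_lfield.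
  by apply/eqP; rewrite -addr_eq0; apply/eqP; exact: is_derive_unique dE d0.
have Ht v z : 'D_v (fun y => mcform a y z) x =
    - mcform a x ('D_v (fun y => lfield a y (mcform a x z)) x).
  by have := H v (mcform a x z); rewrite lfield_mcform.
have alg (p q : V) : - mcform a x p - - mcform a x q = - mcform a x (p - q).
  by rewrite linearB opprB opprK addrC.
apply: etrans (congr2 (fun p q : V => p - q) (Ht u w) (Ht w u)) _.
rewrite alg; congr (- _).
have := lfield_bracket (mcform a x u) (mcform a x w) Aa ax.
have -> : lfield a x (mcform a x u) = u by exact: lfield_mcform.
have -> : lfield a x (mcform a x w) = w by exact: lfield_mcform.
by move=> ->; rewrite mcform_lfield.
Qed.

End MaurerCartan.

Section LieBracket.
Variables (R : realType) (n : nat) (G : lieGroup R n).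
Notation V := 'rV[R]_n.

Lemma lie_bracket_linear X : linear (lie_bracket G X).
Proof.
set e := chart1 G 1%g.
have A1 := atlas_chart1 G; have d1 := chart1_dom G.
have i1 : chart_img (chart1 G) e by exists 1%g.
have dL Y : differentiable (fun y => lfield (chart1 G) y Y) e.
  exact: lfield_differentiable.
have E Y : lie_bracket G X Y = 'D_X (fun y => lfield (chart1 G) y Y) e -
    'd (fun y => lfield (chart1 G) y X) e Y.
  rewrite /lie_bracket /field_bracket -/e.
  have LE Z : left_invariant_field (chart1 G) Z e = Z by exact: lfield_chart1.
  by rewrite !LE; congr (_ - _); exact: (deriveE Y (dL X)).
move=> k Y Z; rewrite !E.
have -> : 'D_X (fun y => lfield (chart1 G) y (k *: Y + Z)) e =
    k *: 'D_X (fun y => lfield (chart1 G) y Y) e + 'D_X (fun y => lfield (chart1 G) y Z) e.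
  have dD W : is_derive e X (fun y => lfield (chart1 G) y W)
      ('D_X (fun y => lfield (chart1 G) y W) e).
    by apply: derivableP; apply: diff_derivable; exact: dL.
  apply: is_derive_unique (dD _) _.
  have -> : (fun y => lfield (chart1 G) y (k *: Y + Z)) =
      (k \*: (fun y => lfield (chart1 G) y Y)) + (fun y => lfield (chart1 G) y Z).
    by apply/funext => y; exact: lfield_linear.
  exact: is_deriveD.
have -> : 'd (fun y => lfield (chart1 G) y X) e (k *: Y + Z) =
    k *: 'd (fun y => lfield (chart1 G) y X) e Y + 'd (fun y => lfield (chart1 G) y X) e Z.
  exact: linearP.
set p := 'D_X _ e; set q := 'D_X _ e; set r := 'd _ e Y; set s := 'd _ e Z.
by move: p q r s => p q r s; rewrite scalerBr opprD addrACA.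
Qed.

End LieBracket.

(** * Geodesics *)

Section ScalarSums.
Variables (R : realType) (n : nat).
Notation V := 'rV[R]_n.

Lemma scalar_row_sum (h : V -> R) (v : V) : scalar h ->
  h v = \sum_i v 0 i * h (coord_vec R i).
Proof.
move=> lh; pose hM := GRing.isLinear.Build _ _ _ _ h lh.
pose hL : {scalar V} := HB.pack h hM.
rewrite -[LHS]/(hL v) [in LHS](row_sum_delta v) linear_sum; apply: eq_bigr => i _.
by rewrite linearZ.
Qed.

Lemma scalar2_row_sum (f : V -> V -> R) (v : V) :
  (forall w, scalar (fun u => f u w)) -> (forall u, scalar (f u)) ->
  \sum_i \sum_j f (coord_vec R i) (coord_vec R j) * v 0 i * v 0 j = f v v.
Proof.
move=> lf1 lf2; rewrite (scalar_row_sum v (lf1 v)); apply: eq_bigr => i _.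
rewrite (scalar_row_sum v (lf2 _)) mulr_sumr; apply: eq_bigr => j _.
by ring.
Qed.

End ScalarSums.

Section FormAlgebra.
Variables (R : realType) (n : nat).
Notation V := 'rV[R]_n.
Notation "''e_' i" := (@coord_vec R n i) (at level 8, i at level 2).
Variables (form : {biscalar V}) (T : V -> V -> V) (th : V -> V).
Hypothesis T1 : forall k u v w, T (k *: u + v) w = k *: T u w + T v w.
Hypothesis T2 : forall k u v w, T u (k *: v + w) = k *: T u v + T u w.
Hypothesis th1 : forall k u v, th (k *: u + v) = k *: th u + th v.

(** Here [th] plays the Maurer-Cartan form and [T u w] its derivative along u evaluated on w, so
    [dm] is the derivative of the metric. Besides T(v, v) only the antisymmetric part of [T]
    survives, which the Maurer-Cartan equation evaluates. *)
Lemma sum_metric_derivatives (v : V) (l : 'I_n) :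
  let dm l i j := form (T 'e_l 'e_i) (th 'e_j) + form (th 'e_i) (T 'e_l 'e_j) in
  form_symmetric form ->
  \sum_i \sum_j (dm i j l + dm j i l - dm l i j) * v 0 i * v 0 j =
  2 * (form (T v v) (th 'e_l) + form (th v) (T v 'e_l - T 'e_l v)).
Proof.
move=> dm form_sym; set w := 'e_l.
pose f u z := form (T u z) (th w) + form (th z) (T u w) +
  (form (T z u) (th w) + form (th u) (T z w)) -
  (form (T w u) (th z) + form (th u) (T w z)).
transitivity (f v v).
  rewrite -(@scalar2_row_sum _ _ f)//.
  - move=> z k u u'; rewrite /f !T1 !T2 !th1.
    by rewrite !(linearPl, linearPr) /=; ring.
  - move=> u k z z'; rewrite /f !T1 !T2 !th1.
    by rewrite !(linearPl, linearPr) /=; ring.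
rewrite /f linearBr (form_sym (T w v)); ring.
Qed.

End FormAlgebra.

(** * The geodesic equation as an Euler-Arnold equation *)

Section EulerArnold.
Variables (R : realType) (n : nat) (G : lieGroup R n).
Notation V := 'rV[R]_n.
Variables (form : {biscalar V}) (U : V -> V -> V).
Hypothesis form_sym : form_symmetric form.
Hypothesis form_nondeg : form_nondegenerate form.
Hypothesis UP : is_Utensor (lie_bracket G) form U.

Lemma lie_bracketC X Y : lie_bracket G X Y = - lie_bracket G Y X.
Proof. by rewrite /lie_bracket /field_bracket opprB. Qed.

Lemma form_U_diag X Z : form (U X X) Z = - form X (lie_bracket G X Z).
Proof.
have two : (2 : R) != 0 by rewrite pnatr_eq0.
apply: (mulfI two); rewrite UP lie_bracketC linearNl (form_sym X); ring.
Qed.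

Opaque mcform.

Section AtPoint.
Variables (a : chart R n G) (x : V).
Hypotheses (Aa : atlas a) (ax : chart_img a x).

Definition mcformD u w := 'D_u (fun y => mcform a y w) x.

Lemma metric_mxE y i j : metric_mx form a y i j =
  form (mcform a y (coord_vec R i)) (mcform a y (coord_vec R j)).
Proof. by rewrite mxE. Qed.

Lemma is_derive_mcform u w : is_derive x u (fun y => mcform a y w) (mcformD u w).
Proof.
by apply: derivableP; apply: diff_derivable; exact: mcform_differentiable.
Qed.

Lemma mcformD_linear1 k u v w : mcformD (k *: u + v) w = k *: mcformD u w + mcformD v w.
Proof.
have dw := mcform_differentiable w Aa ax.
have E z : mcformD z w = 'd (fun y => mcform a y w) x z by exact: (deriveE z dw).
exact: etrans (E _) (etrans (linearP _ k u v)
  (congr2 (fun p q => k *: p + q) (esym (E u)) (esym (E v)))).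
Qed.

Lemma mcformD_linear2 k u v w : mcformD u (k *: v + w) = k *: mcformD u v + mcformD u w.
Proof.
apply: is_derive_unique (is_derive_mcform _ _) _.
have -> : (fun y => mcform a y (k *: v + w)) =
    (k \*: (fun y => mcform a y v)) + (fun y => mcform a y w).
  by apply/funext => y; exact: (linearP (mcform a y) k v w).
apply: is_deriveD; [apply: is_deriveZ|]; exact: is_derive_mcform.
Qed.

Lemma mcformP k u v : mcform a x (k *: u + v) = k *: mcform a x u + mcform a x v.
Proof. exact: linearP. Qed.

Lemma dmetricE l i j (u := @coord_vec R n) : dmetric form a x l i j =
  form (mcformD (u l) (u i)) (mcform a x (u j)) + form (mcform a x (u i)) (mcformD (u l) (u j)).
Proof.
rewrite /dmetric.
have -> : (fun y => metric_mx form a y i j) =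
    (fun y => form (mcform a y (u i)) (mcform a y (u j))).
  by apply/funext => y; rewrite metric_mxE.
by have [_ ->] := is_derive_form form (is_derive_mcform (u l) (u i)) (is_derive_mcform (u l) (u j)).
Qed.

Opaque mcformD.

Lemma form_mcform_eq0 Z : (forall l, form Z (mcform a x (coord_vec R l)) = 0) -> Z = 0.
Proof.
move=> H; apply: form_nondeg => Y; rewrite -(mcform_lfield Y Aa ax).
rewrite (@scalar_row_sum _ _ (fun v => form Z (mcform a x v))).
  by rewrite big1// => i _; rewrite H mulr0.
by move=> k u v; rewrite linearP linearPr.
Qed.

Lemma metric_mx_unit : metric_mx form a x \in unitmx.
Proof.
rewrite -row_free_unit; apply/inj_row_free => v vg0.
rewrite -(lfield_mcform v Aa ax); have -> : mcform a x v = 0.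
  apply: form_mcform_eq0 => l.
  have := congr1 (fun M : V => M 0 l) vg0; rewrite !mxE => <-.
  rewrite (@scalar_row_sum _ _ (fun v => form (mcform a x v) (mcform a x (coord_vec R l)))).
    by apply: eq_bigr => i _; rewrite metric_mxE.
  by move=> k w z; rewrite linearP linearPl.
by rewrite /lfield /left_invariant_field /tangent_map linear0.
Qed.

(** The antisymmetric part is - [X, mcform w] by Maurer-Cartan, and pairing it with X yields U(X, X)
    by [form_U_diag]. *)
Lemma sum_dmetric v l (X := mcform a x v) (w := @coord_vec R n l) :
  \sum_i \sum_j (dmetric form a x i j l + dmetric form a x j i l
    - dmetric form a x l i j) * v 0 i * v 0 j =
  2 * (form (mcformD v v) (mcform a x w) + form (U X X) (mcform a x w)).
Proof.
have MC : mcformD v w - mcformD w v = - lie_bracket G X (mcform a x w).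
  exact: maurer_cartan.
have H := sum_metric_derivatives mcformD_linear1 mcformD_linear2 mcformP v l form_sym.
rewrite form_U_diag -linearNr -MC; apply: etrans H.
apply: eq_bigr => i _; apply: eq_bigr => j _.
by rewrite (dmetricE i j l) (dmetricE j i l) (dmetricE l i j).
Qed.

Lemma christoffel_sumE (v : V) k : 
  \sum_i \sum_j christoffel form a x k i j * v 0 i * v 0 j =
  2^-1 * \sum_l invmx (metric_mx form a x) k l *
    (\sum_i \sum_j (dmetric form a x i j l + dmetric form a x j i l
      - dmetric form a x l i j) * v 0 i * v 0 j).
Proof.
transitivity (\sum_i \sum_j \sum_l 2^-1 * (invmx (metric_mx form a x) k l *
    ((dmetric form a x i j l + dmetric form a x j i l
      - dmetric form a x l i j) * v 0 i * v 0 j))).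
  apply: eq_bigr => i _; apply: eq_bigr => j _.
  rewrite /christoffel mulr_sumr !mulr_suml; apply: eq_bigr => l _; ring.
rewrite mulr_sumr.
under eq_bigr => i _ do rewrite exchange_big/=.
rewrite exchange_big/=; apply: eq_bigr => l _.
rewrite !mulr_sumr; apply: eq_bigr => i _.
by rewrite !mulr_sumr; apply: eq_bigr => j _.
Qed.

(** For a curve with first and second derivatives [v] and [dv], the left side of the last equation
    is the derivative of its left velocity. Lowering the index with the metric removes the inverse
    matrix; then nondegeneracy applies, as the images of the basis under [mcform] span. *)
Lemma geodesic_equation_coordinates (v dv : V) :
  (forall k, dv 0 k + \sum_i \sum_j christoffel form a x k i j * v 0 i * v 0 j = 0)
  <-> mcformD v v + mcform a x dv = - U (mcform a x v) (mcform a x v).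
Proof.
set g := metric_mx form a x; set X := mcform a x v.
pose S : 'cV[R]_n := \col_l
  (form (mcformD v v) (mcform a x (coord_vec R l)) + form (U X X) (mcform a x (coord_vec R l))).
have chE k : dv 0 k + \sum_i \sum_j christoffel form a x k i j * v 0 i * v 0 j =
    (dv^T + invmx g *m S) k 0.
  rewrite christoffel_sumE !mxE; congr (_ + _).
  rewrite mulr_sumr; apply: eq_bigr => l _; rewrite sum_dmetric -/g -/X mxE.
  by field.
have gdv l : (g *m dv^T) l 0 = form (mcform a x dv) (mcform a x (coord_vec R l)).
  rewrite mxE (@scalar_row_sum _ _
    (fun w => form (mcform a x w) (mcform a x (coord_vec R l))) dv); last first.
    by move=> k w z; rewrite linearP linearPl.
  by apply: eq_bigr => k _; rewrite metric_mxE mxE form_sym mulrC.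
have gu : g \in unitmx := metric_mx_unit.
have step : dv^T + invmx g *m S = 0 <-> g *m dv^T + S = 0.
  split=> H.
    have := congr1 (mulmx g) H.
    by rewrite mulmxDr mulmxA mulmxV// mul1mx mulmx0.
  have := congr1 (mulmx (invmx g)) H.
  by rewrite mulmxDr mulmxA mulVmx// mul1mx mulmx0.
split=> [H|H].
  have /step gS : dv^T + invmx g *m S = 0.
    by apply/matrixP => k j; rewrite ord1 -chE H mxE.
  apply/eqP; rewrite -addr_eq0; apply/eqP; apply: form_mcform_eq0 => l.
  have := congr1 (fun M : 'cV[R]_n => M l 0) gS.
  rewrite [LHS]mxE gdv !mxE !linearDl => <-; ring.
suff /step gS : g *m dv^T + S = 0.
  by move=> k; rewrite chE gS mxE.
apply/matrixP => l j; rewrite ord1 mxE gdv !mxE.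
rewrite addrCA addrA -linearDl addrC -linearDl H.
by rewrite addrN linear0l.
Qed.

End AtPoint.
End EulerArnold.

(** * Passage between geodesics and their left velocities *)

Section GeodesicVelocity.
Variables (R : realType) (n : nat) (G : lieGroup R n).
Notation V := 'rV[R]_n.
Variables (form : {biscalar V}) (U : V -> V -> V).
Hypothesis form_sym : form_symmetric form.
Hypothesis form_nondeg : form_nondegenerate form.
Hypothesis UP : is_Utensor (lie_bracket G) form U.

Definition lfieldL (a : chart R n G) (x : V) : {linear V -> V} :=
  'd (a \o left_translation (chart_inv a x) \o chart_inv (chart1 G)) (chart1 G 1%g).

Lemma is_derive1E (W : normedModType R) (f : R -> W) (t : R) d :
  is_derive t 1 f d -> derive1 f t = d.
Proof. by move=> [_ <-]; exact: derive1E. Qed.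

Lemma is_derive_derive1 (W : normedModType R) (f : R -> W) (t : R) :
  derivable f t 1 -> is_derive t 1 f (derive1 f t).
Proof. by move=> df; rewrite derive1E; exact: derivableP. Qed.

(** Both c' = lfield(c) x and x = mcform(c) c' hold near t. The second makes x differentiable when
    c' is; the first gives the converse, part of the geodesic equation as defined. *)
Lemma geodesic_equation_velocity (a : chart R n G) (gamma : R -> G) (x : R -> V) t :
  atlas a -> chart_dom a (gamma t) ->
  (\forall s \near t, velocity gamma s (x s)) ->
  geodesic_equation_at form a gamma t <-> is_derive t 1 x (- U (x t) (x t)).
Proof.
move=> Aa at_ nvel; rewrite /geodesic_equation_at.
set c := a \o gamma.
have [cg _] := nbhs_singleton nvel.
have na : \forall s \near t, chart_dom a (gamma s).
  by apply: cg; exact: near_chart_dom.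
have ndc : \forall s \near t, chart_img a (c s) /\
    is_derive s 1 c (lfield a (c s) (x s)).
  apply: filterS (filterI na nvel) => s [as_ vs]; split; first by exists (gamma s).
  by case: (vs) => cs _; apply/(velocityP _ Aa as_ cs).
have [ac dct] := nbhs_singleton ndc.
have dcE : \forall s \near t, lfield a (c s) (x s) = derive1 c s.
  by apply: filterS ndc => s [_ dcs]; rewrite (is_derive1E dcs).
have xE : \forall s \near t, mcform a (c s) (derive1 c s) = x s.
  by apply: filterS ndc => s [acs dcs]; rewrite (is_derive1E dcs) mcform_lfield.
have dcEt := nbhs_singleton dcE; have xEt := nbhs_singleton xE.
rewrite dcEt in dct; set v := derive1 c t in dcEt xEt dct *.
have dth w : is_derive t 1 (fun s => mcform a (c s) w) (mcformD a (c t) v w).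
  exact: is_derive_comp dct (mcform_differentiable w Aa ac).
have dx : derivable (derive1 c) t 1 -> is_derive t 1 x
    (mcformD a (c t) v v + mcform a (c t) (derive1 (derive1 c) t)).
  move=> /is_derive_derive1 ddc.
  exact: near_eq_is_derive xE (is_derive_apply_linear dth ddc).
have := geodesic_equation_coordinates form_sym form_nondeg UP Aa ac v
  (derive1 (derive1 c) t).
rewrite xEt => gE.
split=> [[_ ddc eq]|dxU].
  by have := dx ddc; rewrite (gE.1 eq).
have ddc : derivable (derive1 c) t 1.
  have dL w : is_derive t 1 (fun s => lfieldL a (c s) w)
      ('D_v (fun y => lfield a y w) (c t)).
    exact: is_derive_comp dct (lfield_differentiable w Aa ac).
  by have [] := near_eq_is_derive dcE (is_derive_apply_linear dL dxU).
have [dc1 _] := dct; split; [exact: dc1|exact: ddc|].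
exact: gE.2 (is_derive_unique (dx ddc) dxU).
Qed.

Lemma geodesic_euler_arnold (I : set R) (gamma : R -> G) : geodesic_on form I gamma ->
  exists x : R -> V, forall t, I t ->
    velocity gamma t (x t) /\ is_derive t 1 x (- U (x t) (x t)).
Proof.
move=> [oI _ _ cI geo].
have cg t : I t -> {for t, continuous gamma} by exact: within_open_continuous.
(* A formula free of the chart around [gamma s], so that a single function x serves along the whole
   geodesic. *)
pose x s := derive1 (fun r => chart1 G ((gamma s)^-1 * gamma r)%g) s.
have vel t : I t -> velocity gamma t (x t).
  move=> It; have Aa := chart_at_atlas (gamma t); have at_ := chart_at_dom (gamma t).
  have [/is_derive_derive1 dc _ _] := geo t It _ Aa at_.
  have acg : chart_img (chart_at (gamma t)) (chart_at (gamma t) (gamma t)).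
    by exists (gamma t).
  have : velocity gamma t (mcform (chart_at (gamma t)) (chart_at (gamma t) (gamma t))
      (derive1 (chart_at (gamma t) \o gamma) t)).
    by apply/(velocityP _ Aa at_ (cg t It)); rewrite lfield_mcform.
  by move=> [_ dX]; split; [exact: cg|rewrite /x (is_derive1E dX)].
exists x => t It; split; first exact: vel.
apply/(geodesic_equation_velocity (chart_at_atlas (gamma t)) (chart_at_dom (gamma t))).
  by apply: filterS (open_nbhs_nbhs (conj oI It)) => s; exact: vel.
by apply: geo => //; [exact: chart_at_atlas|exact: chart_at_dom].
Qed.

Lemma euler_arnold_geodesic (I : set R) (gamma : R -> G) (x : R -> V) :
  open I -> is_interval I -> I !=set0 ->
  (forall t, I t -> velocity gamma t (x t) /\ is_derive t 1 x (- U (x t) (x t))) ->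
  geodesic_on form I gamma.
Proof.
move=> oI iI I0 vel; split => //.
  by rewrite continuous_open_subspace// => t /[!inE] /vel[[]].
move=> t It a Aa at_; apply/(geodesic_equation_velocity Aa at_ (x := x)).
  by apply: filterS (open_nbhs_nbhs (conj oI It)) => s /vel[].
by case: (vel t It).
Qed.

End GeodesicVelocity.

(** * Existence and uniqueness of curves with a given left velocity *)

Section Velocity.
Variables (R : realType) (n : nat) (G : lieGroup R n).
Notation V := 'rV[R]_n.
Notation e := (chart1 G 1%g).
Implicit Types (gamma sigma : R -> G).

Lemma velocity_translation gamma g t X : velocity gamma t X ->
  velocity (fun s => (g * gamma s)%g) t X.
Proof.
move=> [cg dg]; split.
  apply: (@continuous_comp _ _ _ gamma (left_translation g)) => //.
  exact: left_translation_continuous.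
have -> // : (fun s => chart1 G ((g * gamma t)^-1 * (g * gamma s))%g) =
  (fun s => chart1 G ((gamma t)^-1 * gamma s)%g).
by apply/funext => s; rewrite invgM -mulgA mulKg.
Qed.

Lemma near_eq_velocity gamma sigma t X : (\forall s \near t, gamma s = sigma s) ->
  velocity gamma t X -> velocity sigma t X.
Proof.
move=> E [cg dg]; have Et := nbhs_singleton E; split.
  move=> B /=; rewrite -Et => /cg; apply: filterS2 E => s.
  by rewrite /preimage /= => ->.
by apply: near_eq_is_derive dg; apply: filterS E => s ->; rewrite Et.
Qed.

(** In [chart1] the condition becomes y' = lfieldL(y) (P t) with y(b) = e, linear in the control
    P. *)
Lemma exists_velocity (P : R -> V) b : continuous P ->
  exists2 h, 0 < h & exists sigma,
    forall t, `|t - b| < h -> velocity sigma t (P t).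
Proof.
move=> cP; have A1 := atlas_chart1 G; have d1 := chart1_dom G.
have i1 : chart_img (chart1 G) e by exists 1%g.
have Adiff j : \forall x \near e,
    differentiable (fun y => lfieldL (chart1 G) y (delta_mx 0 j : V)) x.
  by apply: filterS (near_chart_img i1) => x ax; exact: lfield_differentiable.
have AC1 i j : {for e, continuous ('D_(delta_mx 0 i : V)
    (fun y => lfieldL (chart1 G) y (delta_mx 0 j : V)))}.
  exact: derive_lfield_continuous.
have [h h0 [y [yb dy]]] := linear_control_ode Adiff AC1 b cP.
have cy t : `|t - b| < h -> {for t, continuous y}.
  move=> tb; apply: differentiable_continuous; apply/derivable1_diffP.
  by have [] := dy t tb.
have yimg : \forall t \near b, chart_img (chart1 G) (y t).
  apply: cy; first by rewrite subrr normr0.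
  by rewrite yb; exact: near_chart_img.
have [d /= d0 Hd] := (nbhs_ballP _ _).1 yimg.
exists (Num.min d h); first by rewrite lt_min d0 h0.
exists (chart_inv (chart1 G) \o y) => t tdh.
have img s : `|s - b| < Num.min d h -> chart_img (chart1 G) (y s).
  rewrite lt_min => /andP[sd _]; apply: Hd.
  by rewrite -ball_normE /= distrC.
have [st yst] := chart_img_inv (img t tdh).
have cs : {for t, continuous (chart_inv (chart1 G) \o y)}.
  apply: continuous_comp; last exact: chart_inv_continuous (img t tdh).
  by apply: cy; move: tdh; rewrite lt_min => /andP[].
apply/(velocityP _ A1 st cs).
rewrite [chart1 G _]yst.
have th : `|t - b| < h by move: tdh; rewrite lt_min => /andP[].
apply: near_eq_is_derive (dy t th).
apply: filterS (near_ball tdh) => s sdh.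
by have [_] := chart_img_inv (img s sdh).
Qed.

Definition quotient_curve gamma sigma (t : R) : G := (gamma t * (sigma t)^-1)%g.

Lemma quotient_curve_continuous gamma sigma t :
  {for t, continuous gamma} -> {for t, continuous sigma} ->
  {for t, continuous (quotient_curve gamma sigma)}.
Proof.
move=> cg cs.
apply: (@continuous2_cvg _ _ _ _ _ _ gamma ((fun g : G => g^-1%g) \o sigma)
  (fun g h : G => (g * h)%g) (gamma t) (sigma t)^-1%g).
- exact (@lie_mul_cont _ _ G (gamma t, (sigma t)^-1%g)).
- exact: cg.
- have ci : {for sigma t, continuous (fun g : G => g^-1%g)}.
    exact (@lie_inv_cont _ _ G (sigma t)).
  exact (@continuous_comp _ _ _ sigma (fun g : G => g^-1%g) t cs ci).
Qed.

(* Independence of the two curves allows the derivative to be computed on left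
   translates of one curve, whose quotient is constant. *)
Lemma quotient_curve_derive (c : chart R n G) (p q : G) X :
  atlas c -> chart_dom c (p * q^-1)%g ->
  exists v, forall gamma sigma t, gamma t = p -> sigma t = q ->
    velocity gamma t X -> velocity sigma t X ->
    is_derive t 1 (c \o quotient_curve gamma sigma) v.
Proof.
move=> Ac cpq.
pose a := chart_at p; pose d := chart_at q; pose d' := chart_at (q^-1)%g.
have Aa : atlas a by exact: chart_at_atlas.
have Ad : atlas d by exact: chart_at_atlas.
have Ad' : atlas d' by exact: chart_at_atlas.
have ap : chart_dom a p by exact: chart_at_dom.
have dq : chart_dom d q by exact: chart_at_dom.
have dq' : chart_dom d' (q^-1)%g by exact: chart_at_dom.
pose iota y := d' (chart_inv d y)^-1%g.
have diota : differentiable iota (d q).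
  apply: smooth_on_differentiable (lie_inv_smooth Ad Ad') _.
  by split; [exists q|rewrite chartK].
have dM : differentiable (mulc a d' c) (a p, d' (q^-1)%g).
  exact: smooth_on_differentiable (mulc_smooth Aa Ad' Ac) (mulc_dom_point ap dq' cpq).
exists ('D_(lfield a (a p) X, 'D_(lfield d (d q) X) iota (d q)) (mulc a d' c) (a p, d' (q^-1)%g)).
move=> gamma sigma t gp sq vg vs.
have [cg _] := vg; have [cs _] := vs.
have ag : chart_dom a (gamma t) by rewrite gp.
have dg := (velocityP X Aa ag cg).1 vg; rewrite gp in dg.
have ds_ : chart_dom d (sigma t) by rewrite sq.
have ds := (velocityP X Ad ds_ cs).1 vs; rewrite sq in ds.
have dis : is_derive t 1 (iota \o (d \o sigma)) ('D_(lfield d (d q) X) iota (d q)).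
  rewrite -[in X in _ X]sq; rewrite -sq in ds diota *.
  exact: is_derive_comp ds diota.
have dpair := is_derive_pair dg dis.
have pt : (fun s => ((a \o gamma) s, (iota \o (d \o sigma)) s)) t = (a p, d' (q^-1)%g).
  by rewrite /= /iota gp sq chartK.
have dM' : differentiable (mulc a d' c) ((fun s => ((a \o gamma) s, (iota \o (d \o sigma)) s)) t).
  by rewrite pt.
have := is_derive_comp dpair dM'; rewrite pt.
apply: near_eq_is_derive.
have n1 : \forall s \near t, chart_dom a (gamma s) by apply: cg; exact: near_chart_dom.
have n2 : \forall s \near t, chart_dom d (sigma s) by apply: cs; exact: near_chart_dom.
have n3 : \forall s \near t, chart_dom d' ((sigma s)^-1)%g.
  have ci : {for sigma t, continuous (fun g : G => g^-1%g)}.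
    exact (@lie_inv_cont _ _ G (sigma t)).
  have : {for t, continuous ((fun g : G => g^-1%g) \o sigma)} by exact: continuous_comp.
  by apply; apply: near_chart_dom; rewrite /= sq.
apply: filterS (filterI (filterI n1 n2) n3) => s [[as_ dss] d's].
by rewrite /= /mulc /= /iota !chartK.
Qed.

Lemma quotient_curve_derive0 (c : chart R n G) gamma sigma t X : atlas c ->
  chart_dom c (quotient_curve gamma sigma t) ->
  velocity gamma t X -> velocity sigma t X ->
  is_derive t 1 (c \o quotient_curve gamma sigma) 0.
Proof.
move=> Ac cw vg vs; have A1 := atlas_chart1 G; have d1 := chart1_dom G.
have i1 : chart_img (chart1 G) e by exists 1%g.
have [v vP] := @quotient_curve_derive c (gamma t) (sigma t) X Ac cw.
suff <- : v = 0 by exact: vP.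
(* A model curve, straight in [chart1], at 1 with velocity X at time t. Its translates by [gamma t]
   and [sigma t] have a constant quotient, so the common derivative [v] is 0. *)
pose zeta (s : R) : G := chart_inv (chart1 G) ((e - t *: X) + s *: X).
have zline : (e - t *: X) + t *: X = e by rewrite subrK.
have dline := is_derive_line (e - t *: X) X t.
have cline : {for t, continuous (fun s : R => (e - t *: X) + s *: X)}.
  by apply: differentiable_continuous; apply/derivable1_diffP; case: dline.
have zt : zeta t = 1%g by rewrite /zeta zline chartK.
have cz : {for t, continuous zeta}.
  apply: (@continuous_comp _ _ _ (fun s : R => (e - t *: X) + s *: X)) => //.
  by rewrite zline; exact: chart_inv_continuous.
have vz : velocity zeta t X.
  have zd : chart_dom (chart1 G) (zeta t) by rewrite zt.
  apply/(velocityP _ A1 zd cz); rewrite zt lfield_chart1.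
  apply: near_eq_is_derive dline.
  have : \forall s \near t, chart_img (chart1 G) ((e - t *: X) + s *: X).
    by apply: cline; rewrite zline; exact: near_chart_img.
  by apply: filterS => s /chart_img_inv[_ E]; exact: esym E.
have := vP (fun s => (gamma t * zeta s)%g) (fun s => (sigma t * zeta s)%g) t.
rewrite zt !mulg1 => /(_ erefl erefl (velocity_translation _ vz) (velocity_translation _ vz)).
have -> : c \o quotient_curve (fun s => (gamma t * zeta s)%g) (fun s => (sigma t * zeta s)%g)
    = cst (c (gamma t * (sigma t)^-1)%g).
  apply/funext => s; rewrite /= /quotient_curve invgM mulgA.
  by rewrite mulgK.
by move=> dv; exact: is_derive_unique dv (is_derive_cst _ _ _).
Qed.

Lemma velocity_unique (K : set R) gamma sigma (x : R -> V) :
  open K -> is_interval K -> K !=set0 ->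
  (forall t, K t -> velocity gamma t (x t) /\ velocity sigma t (x t)) ->
  exists g, forall t, K t -> gamma t = (g * sigma t)%g.
Proof.
move=> oK iK [t0 Kt0] vel; pose w := quotient_curve gamma sigma.
have wloc t : K t -> \forall s \near t, w s = w t.
  move=> Kt; pose c := chart_at (w t).
  have Ac : atlas c by exact: chart_at_atlas.
  have cwt : chart_dom c (w t) by exact: chart_at_dom.
  have [[cg _] [cs _]] := vel t Kt.
  have nw : \forall s \near t, chart_dom c (w s).
    have : {for t, continuous w} by exact: quotient_curve_continuous.
    by apply; exact: near_chart_dom.
  have [r /= r0 Hr] := (nbhs_ballP _ _).1 (filterI nw (open_nbhs_nbhs (conj oK Kt))).
  have Hr' s : `|s - t| < r -> chart_dom c (w s) /\ K s.
    by move=> st; apply: Hr; rewrite -ball_normE /= distrC.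
  have dcw (s : R) : `|s - t| < r -> is_derive s 1 (c \o w) 0.
    move=> /Hr'[cws Ks]; have [vg vs] := vel s Ks.
    exact: quotient_curve_derive0 vg vs.
  have tt : `|t - t| < r by rewrite subrr normr0.
  apply: filterS (near_ball tt) => s st.
  have := is_derive0_constant (@ball_is_interval R t r) dcw st tt.
  move=> /(congr1 (chart_inv c)); rewrite /= !chartK//.
  by have [] := Hr' s st.
exists (w t0) => t Kt; suff <- : w t = w t0 by rewrite /w /quotient_curve mulgVK.
(* The indicator of the set where w equals [w t0], as a 1 x 1 matrix: it is locally constant, so its
   zero derivative propagates the equality along the interval. *)
pose g s : 'rV[R]_1 := if pselect (w s = w t0) then 1 else 0.
have dg (s : R) : K s -> is_derive s 1 g 0.
  move=> Ks; apply: near_eq_is_derive (is_derive_cst (g s) s 1).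
  by apply: filterS (wloc s Ks) => r wrs; rewrite /g wrs.
have := is_derive0_constant iK dg Kt Kt0; rewrite /g.
case: (pselect (w t = w t0)) => [//|wt].
case: (pselect (w t0 = w t0)) => [wt0|//] /= /rowP/(_ 0).
by rewrite !mxE => /esym/eqP; rewrite oner_eq0.
Qed.

End Velocity.

(** * Continuation past a boundary point *)

Section Extension.
Variables (R : realType) (n : nat) (G : lieGroup R n).
Notation V := 'rV[R]_n.

Lemma is_interval_setU (I J : set R) p :
  is_interval I -> is_interval J -> I p -> J p -> is_interval (I `|` J).
Proof.
move=> iI iJ Ip Jp x y [Ix|Jx] [Iy|Jy] z /andP[xz zy].
- by left; apply: iI Ix Iy _ _; apply/andP.
- have [zp|pz] := leP z p.
    by left; apply: iI Ix Ip _ _; apply/andP.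
  by right; apply: iJ Jp Jy _ _; apply/andP; split => //; exact: ltW.
- have [zp|pz] := leP z p.
    by right; apply: iJ Jx Jp _ _; apply/andP.
  by left; apply: iI Ip Iy _ _; apply/andP; split => //; exact: ltW.
- by right; apply: iJ Jx Jy _ _; apply/andP.
Qed.

(** Otherwise [I] would be open, closed and nonempty in the connected line. *)
Lemma exists_boundary_point (I : set R) : open I -> I !=set0 -> I <> setT ->
  exists b, closure I b /\ ~ I b.
Proof.
move=> oI I0 IT; apply: contrapT => nb; apply: IT.
have cI : closed I.
  by move=> b cb; apply: contrapT => nIb; apply: nb; exists b.
have itvT : is_interval [set: R] by [].
have conn := (connected_intervalP [set: R]).2 itvT.
by apply: conn => //; exists I; rewrite // setTI.
Qed.

(** A local curve around [b] meets [I] because b is in its closure. On the overlap, an interval, it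
    differs from [gamma] by a constant left factor; translating by that factor glues the two. *)
Lemma velocity_extension (I : set R) (gamma : R -> G) (P : R -> V) b :
  open I -> is_interval I -> continuous P -> closure I b ->
  (forall t, I t -> velocity gamma t (P t)) ->
  exists (J : set R) (delta : R -> G), [/\ open J, is_interval J, I `<=` J & J b] /\
    {in I, delta =1 gamma} /\ forall t, J t -> velocity delta t (P t).
Proof.
move=> oI iI cP cb vg; have [h h0 [sigma vs]] := exists_velocity G b cP.
pose B := [set t : R | `|t - b| < h].
have Bb : B b by rewrite /B /= subrr normr0.
have oB : open B by rewrite openE => t tB; exact: near_ball.
have [p [Ip Bp]] : I `&` B !=set0 by apply: cb; exact: open_nbhs_nbhs.
have [g gP] : exists g, forall t, (I `&` B) t -> gamma t = (g * sigma t)%g.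
  apply: (@velocity_unique _ _ _ _ _ _ P); first exact: openI.
  - move=> x y [Ix Bx] [Iy By] z xzy; split; first exact: iI Ix Iy _ xzy.
    exact: (@ball_is_interval _ b h) Bx By _ xzy.
  - by exists p.
  - by move=> t [It Bt]; split; [exact: vg|exact: vs].
pose delta t := if pselect (I t) then gamma t else (g * sigma t)%g.
have deltaI t : I t -> delta t = gamma t by rewrite /delta; case: pselect.
have deltaB t : B t -> delta t = (g * sigma t)%g.
  by rewrite /delta; case: pselect => // It Bt; exact: gP.
exists (I `|` B), delta; split; [split|split].
- exact: openU.
- exact: is_interval_setU iI (@ball_is_interval _ b h) Ip Bp.
- by move=> t It; left.
- by right.
- by move=> t /[!inE]; exact: deltaI.
- move=> t [It|Bt].
    apply: near_eq_velocity (vg t It).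
    by apply: filterS (open_nbhs_nbhs (conj oI It)) => s Is; rewrite deltaI.
  apply: near_eq_velocity (velocity_translation g (vs t Bt)).
  by apply: filterS (near_ball Bt) => s Bs; rewrite deltaB.
Qed.

End Extension.

Theorem theorem4p5 (R : realType) (n : nat) (G : lieGroup R n)
    (form : {biscalar 'rV[R]_n}) (U : 'rV[R]_n -> 'rV[R]_n -> 'rV[R]_n) :
  connected [set: G] ->
  form_symmetric form ->
  form_nondegenerate form ->
  is_Utensor (lie_bracket G) form U ->
  class_W0 form U ->
  associative_U U ->
  geodesically_complete G form.
Proof.
move=> _ form_sym form_nondeg UP W0 Ua I gamma [geo maxI].
have [oI iI I0 _ _] := geo.
have [x xP] := geodesic_euler_arnold form_sym form_nondeg UP geo.
have brC := @lie_bracketC R n G.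
have br_lin : forall X, linear (lie_bracket G X) := @lie_bracket_linear R n G.
have Ulin : forall X, linear (U X).
  by move=> X; exact: (Utensor_linear br_lin form_nondeg UP).
have Uc := UtensorC form_nondeg UP.
have Unil : forall X v, iter n (U X) v = 0.
  have tr0 X : \tr (mulU_mx Ulin X) = 0.
    exact: (W0_trace brC form_sym form_nondeg UP (f := mulU Ulin)).
  exact: (mulU_nilpotent Uc Ua tr0).
have [t0 It0] := I0.
have [P [dP PE]] := quadratic_ode_polynomial Ulin Uc Ua Unil iI It0
  (fun t It => (xP t It).2).
have cP : continuous P.
  move=> t; apply: differentiable_continuous; apply/derivable1_diffP.
  by have [] := dP t.
have vP t : I t -> velocity gamma t (P t).
  by move=> It; rewrite PE//; exact: (xP t It).1.
(* Any continuation across a boundary point, however short, contradicts maximality, so the radius of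
   existence there is immaterial. *)
apply: contrapT => /(exists_boundary_point oI I0)[b [cb nIb]].
have [J [delta [[oJ iJ IJ Jb] [deltaE vd]]]] := velocity_extension oI iI cP cb vP.
have J0 : J !=set0 by exists b.
have geoJ : geodesic_on form J delta.
  by apply: (euler_arnold_geodesic form_sym form_nondeg UP oJ iJ J0 (x := P)) => t Jt;
    split; [exact: vd|exact: dP].
by apply: nIb; rewrite -(maxI J delta geoJ IJ deltaE).
Qed.
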